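(* Let $(M,V)$ be an $L_\infty$ algebra $M$ together with an $L_\infty$ module $V$ over it, both of finite dimension over a field $K$ of characteristic zero, such that: - $M^i=0$ and $V^i=0$ for $i\ne 0,1$; - the differentials on $M$ and $V$ are zero; - the linear map $\pi:V^0\otimes(V^1)^\vee\to(M^1)^\vee$ induced from the multiplication map $m_2:M^1\otimes V^0\to V^1$ is injective. Then there exists an $L_\infty$ algebra structure on $M$ isomorphic to the original one such that, for the induced module structure on $V$, $m_2:M\otimes V\to V$ is the original one and the higher multiplication maps $$m_n:(M^1)^{\otimes(n-1)}\otimes V^0\to V^1$$ vanish for all $n>2$.
   Context: Graded means $\mathbb Z$-graded; $L[1]^i=L^{i+1}$; $S(L[1])$ is the graded symmetric coalgebra (coproduct by unshuffles), product written $\vee$, and $\bar S(L[1])=\oplus_{n\ge1}S^n(L[1])$ the reduced one. $\epsilon(\sigma)$ is the Koszul sign with respect to degrees in $L[1]$, and $\mathrm{Sh}(i,j)$ is the set of $(i,j)$-unshuffles (permutations increasing on the first $i$ and on the last $j$ positions). An $L_\infty$ algebra is a graded vector space $L$ with a degree-1 coderivation $Q$ of $\bar S(L[1])$ with $Q^2=0$; its components $q_n:S^n(L[1])\to L[2]$ correspond to graded anti-symmetric maps $l_n:L^{\otimes n}\to L$ of degree $2-n$ via $l_n=-\mathrm{dec}(q_n)$, where $\mathrm{dec}(f)(v_1\wedge\dots\wedge v_n)=(-1)^{\sum_j(n-j)(|v_j|-1)}f(s^{-1}v_1\vee\dots\vee s^{-1}v_n)$ and $s:L[1]\to L$ is the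 tautological degree-1 map. The differential of $L$ is $l_1$. A morphism $(L,Q)\to(L',Q')$ is a coalgebra morphism $F:\bar S(L[1])\to\bar S(L'[1])$ with $FQ=Q'F$; it is an isomorphism iff its linear part $L[1]\to L'[1]$ is. An $L_\infty$ module over $(L,Q)$ is a graded vector space $V$ with a degree-1 map $\phi$ on $S(L[1])\otimes V$ with $\phi\circ\phi=0$, determined by components $\phi_n:S^{n-1}(L[1])\otimes V\to V[1]$ ($n\ge1$) through $$\phi(a_1\vee\dots\vee a_{n-1}\otimes v)=Q(a_1\vee\dots\vee a_{n-1})\otimes v+\sum_{i=0}^{n-1}\sum_{\sigma\in\mathrm{Sh}(i,n-1-i)}(-1)^{\sum_{s\le i}|a_{\sigma(s)}|}\epsilon(\sigma)\,a_{\sigma(1)}\vee\dots\vee a_{\sigma(i)}\otimes\phi_{n-i}(a_{\sigma(i+1)}\vee\dots\vee a_{\sigma(n-1)}\otimes v),$$ with $Q$ extended by $0$ on $S^0$. The multiplication maps are $m_n=-\mathrm{dec}(\phi_n):L^{\otimes(n-1)}\otimes V\to V$ of degree $2-n$, where $\mathrm{dec}$ is applied in the $L$-variables; $m_1$ is the differential of $V$. Given an isomorphism of $L_\infty$ algebras $F:(M,Q)\to(M,Q')$ and a module $(V,\phi)$ over $(M,Q)$, the induced module structure on $V$ over $(M,Q')$ has components $\phi'_\bullet=\phi_\bullet\circ(F^{-1}\otimes\mathrm{id}_V)$, where $\phi_\bullet=\sum_n\phi_n$ and $F^{-1}$ is extended to $S(M[1])$ by $1\mapsto1$. The map $\pi$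 is $\pi(v\otimes\xi)(x)=\xi(m_2(x\otimes v))$. *)

(* Defs.v *)
From HB Require Import structures.
From mathcomp Require Import all_boot all_order all_algebra.
From mathcomp Require Import generic_quotient ring_quotient.
From mathcomp Require Import boolp.
From mathcomp Require Import freeg.

Set Implicit Arguments.
Unset Strict Implicit.
Unset Printing Implicit Defensive.

Import GRing.Theory.
Local Open Scope ring_scope.
Local Open Scope quotient_scope.

Inductive span (K : fieldType) (V : lmodType K) (R : V -> Prop) : V -> Prop :=
| span0 : span R 0
| spanS a r x : R r -> span R x -> span R (a *: r + x).

Section Span.
Variables (K : fieldType) (V : lmodType K) (R : V -> Prop).

Lemma span_gen r : R r -> span R r.
Proof. by move=> Rr; rewrite -[r]scale1r -[_ *: _]addr0; apply: spanS (span0 _). Qed.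

Lemma spanD x y : span R x -> span R y -> span R (x + y).
Proof.
move=> Sx Sy; elim: Sx => [|a r z Rr _ IH]; first by rewrite add0r.
by rewrite -addrA; apply: spanS.
Qed.

Lemma spanZ c x : span R x -> span R (c *: x).
Proof.
elim=> [|a r z Rr _ IH]; first by rewrite scaler0; apply: span0.
by rewrite scalerDr scalerA; apply: spanS.
Qed.

Definition spanb : {pred V} := fun x => `[< span R x >].

Lemma spanbP x : reflect (span R x) (x \in spanb).
Proof. exact: asboolP. Qed.

Lemma spanb_zmod_closed : zmod_closed spanb.
Proof.
split=> [|x y /spanbP Sx /spanbP Sy]; apply/spanbP; first exact: span0.
by apply: spanD => //; rewrite -scaleN1r; apply: spanZ.
Qed.

HB.instance Definition _ := GRing.isZmodClosed.Build V spanb spanb_zmod_closed.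

End Span.

Section Presented.
Variables (K : fieldType) (T : choiceType) (R : {freeg T / K} -> Prop).

Definition pmod : Type := Quotient.quot (spanb R).

HB.instance Definition _ := GRing.Zmodule.on pmod.
HB.instance Definition _ := Quotient.on pmod.

Definition pmod_scale (a : K) (x : pmod) : pmod := \pi_pmod (a *: repr x).

Lemma pmod_eqP (x y : {freeg T / K}) :
  \pi_pmod x = \pi_pmod y <-> span R (x - y).
Proof.
have e := Quotient.idealrBE (spanb R) x y.
split=> [h|/spanbP h]; last by rewrite e in h; move/eqP: h.
by apply/spanbP; rewrite e; apply/eqP.
Qed.

Lemma pi_pmodD x y : \pi_pmod (x + y) = \pi_pmod x + \pi_pmod y.
Proof. exact: (Quotient.pi_add (spanb R) x y). Qed.

Lemma pi_pmodZ a x : \pi_pmod (a *: x) = pmod_scale a (\pi_pmod x).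
Proof.
apply/pmod_eqP; rewrite -scalerBr; apply: spanZ.
by apply/pmod_eqP; rewrite reprK.
Qed.

Lemma pmod_scaleA a b x :
  pmod_scale a (pmod_scale b x) = pmod_scale (a * b) x.
Proof. by rewrite -[x]reprK -(pi_pmodZ b) -!pi_pmodZ scalerA. Qed.

Lemma pmod_scale1 : left_id 1 pmod_scale.
Proof. by move=> x; rewrite -[x]reprK -!pi_pmodZ scale1r. Qed.

Lemma pmod_scaleDr : right_distributive pmod_scale +%R.
Proof.
move=> a x y; rewrite -[x]reprK -[y]reprK.
by rewrite -pi_pmodD -!pi_pmodZ scalerDr pi_pmodD.
Qed.

Lemma pmod_scaleDl x : {morph pmod_scale^~ x : a b / a + b}.
Proof. by move=> a b; rewrite -[x]reprK -!pi_pmodZ scalerDl pi_pmodD. Qed.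

HB.instance Definition _ := GRing.Zmodule_isLmodule.Build K pmod
  pmod_scaleA pmod_scale1 pmod_scaleDr pmod_scaleDl.

Definition pgen (t : T) : pmod := \pi_pmod << t >>.

Lemma pi_pmod_is_linear : linear (\pi_pmod : {freeg T / K} -> pmod).
Proof. by move=> a x y; rewrite pi_pmodD pi_pmodZ. Qed.

Lemma pmod_rel x y : R (x - y) -> \pi_pmod x = \pi_pmod y.
Proof. by move=> Rxy; apply/pmod_eqP/span_gen. Qed.

Lemma pmod_ind (P : pmod -> Prop) :
  P 0 -> (forall a t x, P x -> P (a *: pgen t + x)) -> forall x, P x.
Proof.
move=> P0 PS x; rewrite -[x]reprK -[repr x]freeg_sumE.
elim: (dom _) => [|t s IH].
  rewrite big_nil; suff -> : \pi_pmod 0 = 0 by [].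
  by apply: (addrI (\pi_pmod 0)); rewrite -pi_pmodD !addr0.
rewrite big_cons pi_pmodD.
have -> : << coeff t (repr x) *g t >> = coeff t (repr x) *: << t >>.
  by apply/eqP/freeg_eqP => k; rewrite coeffZ !coeffU mul1r.
by rewrite pi_pmodZ; apply: PS.
Qed.

Section Lift.
Variables (U : lmodType K) (f : T -> U).

Lemma fglift_is_linear : linear (fglift f : {freeg T / K} -> U).
Proof.
move=> a x y.
have fD u v : fglift f (u + v) = fglift f u + fglift f v.
  have fB := lift_is_additive f; have f0 : fglift f 0 = 0.
    by have := fB 0 0; rewrite !subrr.
  have := fB u (- v); rewrite opprK => ->.
  by have := fB 0 v; rewrite !sub0r f0 sub0r => ->; rewrite opprK.
rewrite fD; congr (_ + _).
have gsum (I : Type) (r : seq I) F :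
    fglift f (\sum_(i <- r) F i) = \sum_(i <- r) fglift f (F i).
  elim: r => [|i r IH]; last by rewrite !big_cons fD IH.
  by rewrite !big_nil; apply: (addrI (fglift f 0)); rewrite -fD !addr0.
rewrite -[in RHS](freeg_sumE x) -[a *: x]/(fgscale a x) /fgscale !gsum.
by rewrite scaler_sumr; apply: eq_bigr => t _; rewrite !liftU scalerA.
Qed.

HB.instance Definition _ :=
  GRing.isLinear.Build K {freeg T / K} U _ (fglift f) fglift_is_linear.

Lemma fglift_gen t : fglift f << t >> = f t.
Proof. by rewrite liftU scale1r. Qed.

Definition plift (x : pmod) : U := fglift f (repr x).

Hypothesis fR : forall r, R r -> fglift f r = 0.

Lemma plift_pi x : plift (\pi_pmod x) = fglift f x.
Proof.
suff : span R (repr (\pi_pmod x) - x).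
  move=> S; apply/eqP; rewrite -subr_eq0 /plift -linearB; apply/eqP;
  elim: S => [|a r z Rr _ IH].
    by rewrite linear0.
  by rewrite linearP IH /= fR // scaler0 addr0.
by apply/pmod_eqP; rewrite reprK.
Qed.

Lemma plift_is_linear : linear plift.
Proof.
move=> a x y; rewrite -[x]reprK -[y]reprK -pi_pmod_is_linear !plift_pi.
by rewrite linearP.
Qed.

Lemma pliftE t : plift (pgen t) = f t.
Proof. by rewrite plift_pi fglift_gen. Qed.

End Lift.

End Presented.

Section Tensor.
Variables (K : fieldType) (A B : lmodType K).

Inductive tens_rel : {freeg (A * B)%type / K} -> Prop :=
| tens_rell c a a' b :
    tens_rel (<< (c *: a + a', b) >> - (c *: << (a, b) >> + << (a', b) >>))
| tens_relr c a b b' :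
    tens_rel (<< (a, c *: b + b') >> - (c *: << (a, b) >> + << (a, b') >>)).

Definition tens := pmod tens_rel.
HB.instance Definition _ := GRing.Lmodule.on tens.

Definition tpure (a : A) (b : B) : tens := pgen tens_rel (a, b).

Lemma tpureDl c a a' b : tpure (c *: a + a') b = c *: tpure a b + tpure a' b.
Proof.
by rewrite -[RHS]pi_pmod_is_linear; apply: pmod_rel; apply: tens_rell.
Qed.

Lemma tpureDr c a b b' : tpure a (c *: b + b') = c *: tpure a b + tpure a b'.
Proof.
by rewrite -[RHS]pi_pmod_is_linear; apply: pmod_rel; apply: tens_relr.
Qed.

Lemma tpure0l b : tpure 0 b = 0.
Proof.
have := tpureDl 1 0 0 b; rewrite scaler0 addr0 scale1r => e.
by apply: (addrI (tpure 0 b)); rewrite -e addr0.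
Qed.

Lemma tpure0r a : tpure a 0 = 0.
Proof.
have := tpureDr 1 a 0 0; rewrite scaler0 addr0 scale1r => e.
by apply: (addrI (tpure a 0)); rewrite -e addr0.
Qed.

Lemma tpureZl c a b : tpure (c *: a) b = c *: tpure a b.
Proof. by have := tpureDl c a 0 b; rewrite tpure0l !addr0. Qed.

Lemma tpureZr c a b : tpure a (c *: b) = c *: tpure a b.
Proof. by have := tpureDr c a b 0; rewrite tpure0r !addr0. Qed.

Lemma tens_ind (P : tens -> Prop) :
  P 0 -> (forall c a b x, P x -> P (c *: tpure a b + x)) -> forall x, P x.
Proof. by move=> P0 PS; apply: pmod_ind => // c [a b] x; apply: PS. Qed.

Section Lift.
Variables (U : lmodType K) (f : A -> B -> U).

Definition tlift : tens -> U := plift (uncurry f).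

Hypothesis fl : forall b, linear (f^~ b).
Hypothesis fr : forall a, linear (f a).

Let f_rel r : tens_rel r -> fglift (uncurry f) r = 0.
Proof.
by case=> *; rewrite linearB linearP /= !fglift_gen /= ?fl ?fr subrr.
Qed.

Lemma tlift_is_linear : linear tlift. Proof. exact: plift_is_linear f_rel. Qed.

Lemma tliftE a b : tlift (tpure a b) = f a b. Proof. exact: (pliftE f_rel). Qed.
End Lift.

End Tensor.

Notation "a ⊗ b" := (tpure a b) (at level 40, left associativity) : ring_scope.

Section TensorMap.
Variables (K : fieldType) (A B A' B' : lmodType K).
Variables (f : {linear A -> A'}) (g : {linear B -> B'}).

Definition tmap : tens A B -> tens A' B' := tlift (fun a b => f a ⊗ g b).

Let tmapl b : linear (fun a => f a ⊗ g b).
Proof. by move=> c a a'; rewrite linearP tpureDl. Qed.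

Let tmapr a : linear (fun b => f a ⊗ g b).
Proof. by move=> c b b'; rewrite linearP tpureDr. Qed.

HB.instance Definition _ :=
  GRing.isLinear.Build K (tens A B) (tens A' B') _ tmap
    (tlift_is_linear tmapl tmapr).

Lemma tmapE a b : tmap (a ⊗ b) = f a ⊗ g b.
Proof. exact: (tliftE tmapl tmapr). Qed.
End TensorMap.

Section Graded.
Variables (K : fieldType) (W : int -> lmodType K).

(* a homogeneous element together with its degree [tag x] *)
Definition hel := {i : int & W i}.
HB.instance Definition _ := Choice.copy hel {i : int & (W i : choiceType)}.

Definition Hel i (x : W i) : hel := Tagged (fun i => W i : Type) x.

Inductive dsum_rel : {freeg hel / K} -> Prop :=
  Dsum_rel i c (x y : W i) :
    dsum_rel (<< Hel (c *: x + y) >> - (c *: << Hel x >> + << Hel y >>)).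

(* the total space, i.e. the direct sum of the W i *)
Definition dsum := pmod dsum_rel.
HB.instance Definition _ := GRing.Lmodule.on dsum.

Definition din (x : hel) : dsum := pgen dsum_rel x.

Lemma dinD i c (x y : W i) :
  din (Hel (c *: x + y)) = c *: din (Hel x) + din (Hel y).
Proof.
by rewrite -[RHS]pi_pmod_is_linear; apply: pmod_rel; apply: Dsum_rel.
Qed.

Section Lift.
Variables (U : lmodType K) (f : hel -> U).

Definition dlift : dsum -> U := plift f.

Hypothesis fl : forall i, linear (fun x : W i => f (Hel x)).

Let f_rel r : dsum_rel r -> fglift f r = 0.
Proof. by case=> *; rewrite linearB linearP /= !fglift_gen /= fl subrr. Qed.

Lemma dlift_is_linear : linear dlift. Proof. exact: plift_is_linear f_rel. Qed.

Lemma dliftE x : dlift (din x) = f x. Proof. exact: (pliftE f_rel). Qed.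
End Lift.

Definition hcomp i (x : hel) : W i :=
  untag 0 (fun y : W i => y) (x : {i : int & (W i : Type)}).

Definition dproj i : dsum -> W i := dlift (hcomp i).

Let hcomp_linear i j : linear (fun x : W j => hcomp i (Hel x)).
Proof.
move=> c x y; rewrite /hcomp /untag /=.
case: eqP => [e|_]; last by rewrite scaler0 addr0.
by move: e; rewrite /Hel /= => e; case: i / e.
Qed.

HB.instance Definition _ i :=
  GRing.isLinear.Build K dsum (W i) _ (dproj i) (dlift_is_linear (hcomp_linear i)).

Lemma dprojE i (x : W i) : dproj i (din (Hel x)) = x.
Proof. by rewrite /dproj (dliftE (hcomp_linear i)) /hcomp untagE. Qed.

Lemma dproj_neq i (x : hel) : tag x != i -> dproj i (din x) = 0.
Proof.
by move=> ne; rewrite /dproj (dliftE (hcomp_linear i)) /hcomp untag_dflt.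
Qed.

End Graded.

Arguments din {K W} x.
Arguments dproj {K W} i x.
Arguments Hel {K W i} x.

(* L[1]^i = L^(i+1) *)
Definition shift (K : fieldType) (L : int -> lmodType K) : int -> lmodType K :=
  fun i => L (i + 1).

Section Shift.
Variables (K : fieldType) (L : int -> lmodType K).

Definition susp (x : hel (shift L)) : hel L :=
  Hel (tagged x : L (tag x + 1)).

Definition desusp (x : hel L) : hel (shift L) :=
  @Hel K (shift L) (tag x - 1)
    (ecast i (L i) (esym (subrK 1 (tag x))) (tagged x)).

Lemma suspK x : susp (desusp x) = x.
Proof.
case: x => i x; rewrite /susp /desusp /Hel /=.
by case: _ / (esym (subrK 1 i)).
Qed.

Definition dsusp : dsum (shift L) -> dsum L := dlift (fun x => din (susp x)).

Let dsusp_lin i : linear (fun x : shift L i => din (susp (Hel x))).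
Proof. by move=> c x y; rewrite /susp /= dinD. Qed.

HB.instance Definition _ :=
  GRing.isLinear.Build K (dsum (shift L)) (dsum L) _ dsusp
    (dlift_is_linear dsusp_lin).

Lemma dsuspE x : dsusp (din x) = din (susp x).
Proof. exact: (dliftE dsusp_lin). Qed.

End Shift.

Section SymCoalgebra.
Variables (K : fieldType) (W : int -> lmodType K).
Local Notation word := (seq (hel W)).

Definition wdeg (w : word) : int := \sum_(x <- w) tag x.

Inductive sym_rel : {freeg word / K} -> Prop :=
| sym_lin u i c (x y : W i) v :
    sym_rel (<< u ++ Hel (c *: x + y) :: v >>
             - (c *: << u ++ Hel x :: v >> + << u ++ Hel y :: v >>))
| sym_swap u a b v :
    sym_rel (<< u ++ a :: b :: v >>
             - (-1) ^ (tag a * tag b) *: << u ++ b :: a :: v >>)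
| sym_nil : sym_rel << [::] >>.

(* The direct sum of the S^n(W), n >= 1: the empty word is killed. *)
Definition rsym := pmod sym_rel.
HB.instance Definition _ := GRing.Lmodule.on rsym.

(* the product of the letters of a word *)
Definition vee (w : word) : rsym := pgen sym_rel w.

Definition graded_symmetric (U : lmodType K) (f : word -> U) : Prop :=
  (forall u i c (x y : W i) v,
     f (u ++ Hel (c *: x + y) :: v) = c *: f (u ++ Hel x :: v) + f (u ++ Hel y :: v))
  /\ (forall u a b v,
     f (u ++ a :: b :: v) = (-1) ^ (tag a * tag b) *: f (u ++ b :: a :: v)).

Lemma vee_nil : vee [::] = 0.
Proof.
have -> : (0 : rsym) = \pi_rsym 0.
  by apply: (addrI (\pi_rsym 0)); rewrite -pi_pmodD !addr0.
by apply: pmod_rel; rewrite subr0; apply: sym_nil.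
Qed.

Lemma vee_graded_symmetric : graded_symmetric vee.
Proof.
split=> [u i c x y v|u a b v].
  by rewrite -[RHS]pi_pmod_is_linear; apply: pmod_rel; apply: sym_lin.
have piZ c t : c *: vee t = \pi_rsym (c *: << t >>) by rewrite pi_pmodZ.
by rewrite piZ; apply: pmod_rel; apply: sym_swap.
Qed.

Lemma rsym_ind (P : rsym -> Prop) :
  P 0 -> (forall c w x, P x -> P (c *: vee w + x)) -> forall x, P x.
Proof. by move=> P0 PS; apply: pmod_ind. Qed.

Section Lift.
Variables (U : lmodType K) (f : word -> U).

Definition slift : rsym -> U := plift f.

Hypotheses (fs : graded_symmetric f) (f0 : f [::] = 0).

Let f_rel r : sym_rel r -> fglift f r = 0.
Proof.
case: fs => fl fw; case=> [u i c x y v|u a b v|].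
- by rewrite linearB linearP /= !fglift_gen /= fl subrr.
- by rewrite linearB linearZ /= !fglift_gen /= fw subrr.
- by rewrite fglift_gen.
Qed.

Lemma slift_is_linear : linear slift. Proof. exact: plift_is_linear f_rel. Qed.

Lemma sliftE w : slift (vee w) = f w. Proof. exact: (pliftE f_rel). Qed.
End Lift.

(* A mask m of length n encodes the unshuffle s in Sh(i, n - i), i the number
   of true entries: s lists in increasing order the positions where m is true,
   then those where it is false. *)
Fixpoint koszul (m : bitseq) (w : word) : K :=
  match m, w with
  | b :: m', a :: w' =>
      (if b then 1 else (-1) ^ (tag a * wdeg (mask m' w'))) * koszul m' w'
  | _, _ => 1
  end.

(* the sum over all i and all unshuffles s in Sh(i, n - i) of
   eps(s) f (w_s(1) .. w_s(i)) (w_s(i+1) .. w_s(n)) *)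
Definition unshuffle (U : lmodType K) (f : word -> word -> U) (w : word) : U :=
  \sum_(m : (size w).-tuple bool)
    koszul m w *: f (mask m w) (mask (map negb m) w).

Lemma unshuffle_nil (U : lmodType K) (f : word -> word -> U) :
  unshuffle f [::] = f [::] [::].
Proof.
rewrite /unshuffle (big_pred1 [tuple]) ?scale1r // => m.
by apply/esym/eqP; apply: tuple0.
Qed.

Lemma unshuffle_cons (U : lmodType K) (f : word -> word -> U) a w :
  unshuffle f (a :: w) =
  unshuffle (fun u v => f (a :: u) v + (-1) ^ (tag a * wdeg u) *: f u (a :: v)) w.
Proof.
rewrite /unshuffle /=.
pose h (p : bool * (size w).-tuple bool) := [tuple of p.1 :: p.2].
rewrite (reindex h) /=; last first.
  exists (fun m => (thead m, [tuple of behead m])) => [[b m] _|m _].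
    by rewrite /h theadE; congr pair; apply/val_inj.
  by rewrite /h /= [RHS]tuple_eta.
rewrite -(pair_bigA _ (fun b m => koszul (h (b, m)) (a :: w) *:
  f (mask (h (b, m)) (a :: w)) (mask (map negb (h (b, m))) (a :: w)))) /=.
rewrite big_bool /= -big_split /=; apply: eq_bigr => m _.
by rewrite mul1r scalerDr scalerA [koszul _ _ * _]mulrC.
Qed.

Lemma wdeg_cons a w : wdeg (a :: w) = tag a + wdeg w.
Proof. by rewrite /wdeg big_cons. Qed.

Lemma wdeg_cat u v : wdeg (u ++ v) = wdeg u + wdeg v.
Proof. by rewrite /wdeg big_cat. Qed.

Lemma signzD (m n : int) : (-1) ^ (m + n) = (-1) ^ m * (-1) ^ n :> K.
Proof. by rewrite expfzDr // oppr_eq0 oner_eq0. Qed.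

Lemma signzK (m : int) : (-1) ^ m * (-1) ^ m = 1 :> K.
Proof. by rewrite -expfzMl mulrNN mul1r exp1rz. Qed.

Lemma unshuffle_graded_symmetric (U : lmodType K) (f : word -> word -> U) :
  (forall v, graded_symmetric (f^~ v)) -> (forall u, graded_symmetric (f u)) ->
  graded_symmetric (unshuffle f).
Proof.
pose shift_f a (g : word -> word -> U) u v :=
  g (a :: u) v + (-1) ^ (tag a * wdeg u) *: g u (a :: v).
have shiftP g a : (forall v, graded_symmetric (g^~ v)) ->
    (forall u, graded_symmetric (g u)) ->
  (forall v, graded_symmetric ((shift_f a g)^~ v)) /\
  (forall u, graded_symmetric (shift_f a g u)).
  move=> gl gr; split=> [v|u]; split.
  - move=> u i c x y t; have /= e := (gl v).1 (a :: u) i c x y t.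
    rewrite /shift_f e (gl _).1 !wdeg_cat !wdeg_cons /= !scalerDr !scalerA.
    by rewrite [c * _]mulrC addrACA.
  - move=> u b b' t; have /= e := (gl v).2 (a :: u) b b' t.
    rewrite /shift_f e (gl _).2 !wdeg_cat !wdeg_cons /= !scalerDr !scalerA.
    by rewrite [tag b' + (_ + _)]addrCA [X in _ + X *: _]mulrC.
  - move=> t i c x y v; rewrite /shift_f (gr _).1.
    have /= -> := (gr u).1 (a :: t) i c x y v.
    by rewrite !scalerDr !scalerA [c * _]mulrC addrACA.
  - move=> t b b' v; rewrite /shift_f (gr _).2.
    have /= -> := (gr u).2 (a :: t) b b' v.
    by rewrite !scalerDr !scalerA [X in _ + X *: _]mulrC.
move=> fl fr; split.
  move=> u; elim: u f fl fr => [|a u IH] f fl fr i c x y v; last first.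
    by rewrite !cat_cons !unshuffle_cons; apply: IH; case: (shiftP f a fl fr).
  rewrite !cat0s !unshuffle_cons /unshuffle /= scaler_sumr -big_split /=.
  apply: eq_bigr => m _; rewrite scalerA [c * _]mulrC -scalerA -scalerDr.
  congr (_ *: _).
  have := (fl (mask (map negb m) v)).1 [::] i c x y (mask m v) => /= ->.
  have := (fr (mask m v)).1 [::] i c x y (mask (map negb m) v) => /= ->.
  by rewrite !scalerDr !scalerA [c * _]mulrC addrACA.
move=> u; elim: u f fl fr => [|d u IH] f fl fr a b v; last first.
  by rewrite !cat_cons !unshuffle_cons; apply: IH; case: (shiftP f d fl fr).
rewrite !cat0s !unshuffle_cons /unshuffle /= scaler_sumr.
apply: eq_bigr => m _; rewrite scalerA [_ ^ _ * koszul _ _]mulrC -scalerA.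
congr (_ *: _); set p := mask m v; set q := mask (map negb m) v.
have := (fl q).2 [::] a b p => /= ->.
have := (fr p).2 [::] a b q => /= ->.
rewrite !scalerDr !scalerA !wdeg_cons !mulrDr !signzD.
rewrite [tag b * tag a]mulrC -!addrA; congr (_ + _).
rewrite addrCA; congr (_ + (_ + _)); first by rewrite mulrA signzK mul1r.
by congr (_ *: _); rewrite mulrC -!mulrA; congr (_ * _); rewrite mulrC.
Qed.

(* [koszul] is the Koszul sign. *)
Lemma vee_unshuffle (m : bitseq) (w : word) : size m = size w ->
  vee w = koszul m w *: vee (mask m w ++ mask (map negb m) w).
Proof.
move=> H.
have [_ sw] := vee_graded_symmetric.
have move_a a p u v :
    vee (p ++ a :: u ++ v) = (-1) ^ (tag a * wdeg u) *: vee (p ++ u ++ a :: v).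
  elim: u p => [|b u IH] p; first by rewrite /wdeg big_nil mulr0 scale1r.
  rewrite cat_cons sw -cat_rcons IH scalerA cat_rcons.
  by rewrite wdeg_cons mulrDr signzD.
suff gen p : vee (p ++ w) =
    koszul m w *: vee (p ++ mask m w ++ mask (map negb m) w) by exact: (gen [::]).
elim: w m p H => [|a w IH] [|b m] p //= => [_|[sz]]; first by rewrite scale1r.
rewrite -cat_rcons (IH _ _ sz); case: b => /=; rewrite cat_rcons ?mul1r //.
by rewrite move_a scalerA mulrC.
Qed.

Definition coprod_word (w : word) : tens rsym rsym :=
  unshuffle (fun u v => vee u ⊗ vee v) w.

(* Since vee [::] = 0, only the unshuffles in Sh(i, n - i) with 0 < i < n
   contribute. *)
Definition coprod : rsym -> tens rsym rsym := slift coprod_word.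

Let coprod_sym : graded_symmetric coprod_word.
Proof.
have [vl vs] := vee_graded_symmetric.
apply: unshuffle_graded_symmetric => u; split=> *.
- by rewrite vl tpureDl.
- by rewrite vs tpureZl.
- by rewrite vl tpureDr.
- by rewrite vs tpureZr.
Qed.

Let coprod_nil : coprod_word [::] = 0.
Proof.
by rewrite /coprod_word unshuffle_nil vee_nil tpure0l.
Qed.

HB.instance Definition _ :=
  GRing.isLinear.Build K rsym (tens rsym rsym) _ coprod
    (slift_is_linear coprod_sym coprod_nil).

Lemma coprodE w : coprod (vee w) = unshuffle (fun u v => vee u ⊗ vee v) w.
Proof. exact: (sliftE coprod_sym coprod_nil). Qed.

(* x |-> (-1)^|x| x *)
Definition parity : rsym -> rsym := slift (fun w => (-1) ^ wdeg w *: vee w).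

Let parity_sym : graded_symmetric (fun w => (-1) ^ wdeg w *: vee w).
Proof.
have [vl vs] := vee_graded_symmetric; split=> [u i c x y v|u a b v].
  rewrite vl !wdeg_cat !wdeg_cons /= scalerDr !scalerA.
  by rewrite [c * _]mulrC.
rewrite vs !wdeg_cat !wdeg_cons [tag b + (_ + _)]addrCA !scalerA.
by rewrite [_ ^ (tag a * _) * _]mulrC.
Qed.

Let parity_nil : (-1) ^ wdeg [::] *: vee [::] = 0.
Proof. by rewrite vee_nil scaler0. Qed.

HB.instance Definition _ :=
  GRing.isLinear.Build K rsym rsym _ parity
    (slift_is_linear parity_sym parity_nil).

Lemma parityE w : parity (vee w) = (-1) ^ wdeg w *: vee w.
Proof. exact: (sliftE parity_sym parity_nil). Qed.

(* the projection onto S^1(W) = W *)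
Definition lin_word (w : word) : dsum W := if w is [:: x] then din x else 0.
Definition slin : rsym -> dsum W := slift lin_word.

Let lin_sym : graded_symmetric lin_word.
Proof.
split=> [[|b u] i c x y [|d v]|[|d [|e u]] a b v] /=;
  rewrite ?scaler0 ?addr0 ?dinD //; case: u => [|e u];
  by rewrite /= ?scaler0 ?addr0.
Qed.

HB.instance Definition _ :=
  GRing.isLinear.Build K rsym (dsum W) _ slin
    (slift_is_linear lin_sym (erefl 0)).

Lemma slinE w : slin (vee w) = if w is [:: x] then din x else 0.
Proof. exact: (sliftE lin_sym (erefl 0)). Qed.

Definition shomog (d : int) : rsym -> Prop :=
  span (fun x => exists2 w, wdeg w = d & x = vee w).

(* the full coalgebra S(W) = K (+) \bar S(W) *)
Definition sym := (K^o * rsym)%type.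
HB.instance Definition _ := GRing.Lmodule.on sym.

Definition svee (w : word) : sym := ((w == [::])%:R, vee w).

End SymCoalgebra.

Arguments vee {K W} w.
Arguments svee {K W} w.
Arguments coprod {K W} x.
Arguments parity {K W} x.
Arguments slin {K W} x.

Definition has_degree (A B : Type) (hA : int -> A -> Prop) (hB : int -> B -> Prop)
    (k : int) (f : A -> B) : Prop :=
  forall d x, hA d x -> hB (d + k) (f x).

(* (-1)^(sum_j (n - j) (|v_j| - 1)), where w = v_1 .. v_n *)
Definition dec_sign (K : fieldType) (L : int -> lmodType K) (w : seq (hel L)) : K :=
  (-1) ^ (\sum_(j < size w)
            (size w - j.+1)%N%:Z * (tag (tnth (in_tuple w) j) - 1)).

Lemma dec_sign1 (K : fieldType) (L : int -> lmodType K) (x : hel L) :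
  dec_sign [:: x] = 1.
Proof. by rewrite /dec_sign big_ord_recl big_ord0 mul0r addr0. Qed.

Section LInfinity.
Variables (K : fieldType) (L L' : int -> lmodType K).
Local Notation S := (rsym (shift L)).
Local Notation S' := (rsym (shift L')).

(* id (x) Q acts on x (x) y as (-1)^|x| x (x) Q y *)
Definition coderivation (Q : {linear S -> S}) : Prop :=
  forall x, coprod (Q x) = tmap Q idfun (coprod x) + tmap parity Q (coprod x).

Definition Linfty_algebra (Q : {linear S -> S}) : Prop :=
  [/\ has_degree (@shomog K (shift L)) (@shomog K (shift L)) 1 Q,
      coderivation Q
    & forall x, Q (Q x) = 0].

(* l_n (v_1, .., v_n) *)
Definition Linfty_bracket (Q : {linear S -> S}) (w : seq (hel L)) : dsum L :=
  - (dec_sign w *: dsusp (slin (Q (vee (map (@desusp K L) w))))).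

Definition Linfty_morphism (Q : {linear S -> S}) (Q' : {linear S' -> S'})
    (F : {linear S -> S'}) : Prop :=
  [/\ has_degree (@shomog K (shift L)) (@shomog K (shift L')) 0 F,
      forall x, coprod (F x) = tmap F F (coprod x)
    & forall x, F (Q x) = Q' (F x)].

End LInfinity.

Definition Linfty_iso (K : fieldType) (L L' : int -> lmodType K)
    (Q : {linear rsym (shift L) -> rsym (shift L)})
    (Q' : {linear rsym (shift L') -> rsym (shift L')})
    (F : {linear rsym (shift L) -> rsym (shift L')})
    (G : {linear rsym (shift L') -> rsym (shift L)}) : Prop :=
  [/\ Linfty_morphism Q Q' F, Linfty_morphism Q' Q G, cancel F G & cancel G F].

Section Extension.
Variables (K : fieldType) (W W' : int -> lmodType K).
Variable f : {linear rsym W -> rsym W'}.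

(* the extensions of f with 1 |-> 0 and with 1 |-> 1 *)
Definition ext0 (x : sym W) : sym W' := (0, f x.2).
Definition ext1 (x : sym W) : sym W' := (x.1, f x.2).

Let ext0_linear : linear ext0.
Proof. by move=> c x y; rewrite /ext0 linearP; congr pair; rewrite [RHS]addr0 [RHS]scaler0. Qed.

Let ext1_linear : linear ext1.
Proof. by move=> c x y; rewrite /ext1 !linearP. Qed.

HB.instance Definition _ := GRing.isLinear.Build K (sym W) (sym W') _ ext0 ext0_linear.
HB.instance Definition _ := GRing.isLinear.Build K (sym W) (sym W') _ ext1 ext1_linear.
End Extension.

Section Module.
Variables (K : fieldType) (L V : int -> lmodType K).
Local Notation S := (rsym (shift L)).
Local Notation SV := (tens (sym (shift L)) (dsum V)).

Definition SVhomog (d : int) : SV -> Prop :=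
  span (fun x => exists2 p : seq (hel (shift L)) * hel V,
                   wdeg p.1 + tag p.2 = d & x = svee p.1 ⊗ din p.2).

(* the projection of S(L[1]) (x) V onto S^0(L[1]) (x) V = V *)
Definition SVproj : SV -> dsum V := 
  tlift (fun (s : sym (shift L)) (v : dsum V) => (s.1 : K) *: v).

Let SVproj_l (v : dsum V) : linear (fun s : sym (shift L) => (s.1 : K) *: v).
Proof. by move=> c s t /=; rewrite scalerDl scalerA. Qed.

Let SVproj_r (s : sym (shift L)) : linear (fun v : dsum V => (s.1 : K) *: v).
Proof. by move=> c v v'; rewrite scalerDr !scalerA mulrC. Qed.

HB.instance Definition _ :=
  GRing.isLinear.Build K SV (dsum V) _ SVproj (tlift_is_linear SVproj_l SVproj_r).

Lemma SVprojE (s : sym (shift L)) (v : dsum V) : SVproj (s ⊗ v) = (s.1 : K) *: v.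
Proof. exact: (tliftE SVproj_l SVproj_r). Qed.

(* phi_bullet, the sum of the components phi_n *)
Definition component (phi : {linear SV -> SV}) (x : SV) : dsum V := SVproj (phi x).

Definition Linfty_module (Q : {linear S -> S}) (phi : {linear SV -> SV}) : Prop :=
  [/\ has_degree SVhomog SVhomog 1 phi,
      forall x, phi (phi x) = 0
    & forall (w : seq (hel (shift L))) (v : hel V),
        phi (svee w ⊗ din v) =
          ext0 Q (svee w) ⊗ din v
          + unshuffle (fun u u' => (-1) ^ wdeg u *:
              (svee u ⊗ component phi (svee u' ⊗ din v))) w].

(* m_n (v_1, .., v_(n-1), v); the sign only involves the n - 1 arguments in L,
   i.e. it is (-1)^(sum_j (n - 1 - j) (|v_j| - 1)) *)
Definition module_mult (phi : {linear SV -> SV}) (w : seq (hel L)) (v : hel V) :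
    dsum V :=
  - (dec_sign w *: component phi (svee (map (@desusp K L) w) ⊗ din v)).

Lemma module_mult2l phi i v :
  linear (fun x : L i => module_mult phi [:: Hel x] v).
Proof.
move=> c x y; rewrite /module_mult !dec_sign1 !scale1r /=.
have -> : svee [:: desusp (Hel (c *: x + y))] =
    c *: svee [:: desusp (Hel x)] + svee [:: desusp (Hel y)].
  have castD j (e : i = j) : ecast i (L i) e (c *: x + y) =
      c *: ecast i (L i) e x + ecast i (L i) e y by case: j / e.
  rewrite /svee /desusp /= castD.
  have /= -> := (vee_graded_symmetric (shift L)).1 [::] (i - 1) c _ _ [::].
  by congr pair; rewrite [RHS]addr0 [RHS]scaler0.
by rewrite tpureDl /component !linearP.
Qed.

Lemma module_mult2r phi w i :
  linear (fun v : V i => module_mult phi w (Hel v)).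
Proof.
by move=> c v v'; rewrite /module_mult dinD tpureDr /component !linearP.
Qed.

End Module.

Definition induced_module (K : fieldType) (L L' V : int -> lmodType K)
    (G : {linear rsym (shift L') -> rsym (shift L)})
    (phi : {linear tens (sym (shift L)) (dsum V) -> tens (sym (shift L)) (dsum V)})
    (phi' : {linear tens (sym (shift L')) (dsum V) -> tens (sym (shift L')) (dsum V)}) :
    Prop :=
  forall x, component phi' x = component phi (tmap (ext1 G) idfun x).

Section Pi.
Variables (K : fieldType) (M V : int -> vectType K).
Variable phi :
  {linear tens (sym (shift M)) (dsum V) -> tens (sym (shift M)) (dsum V)}.

(* the component m_2 : M^1 (x) V^0 -> V^1 *)
Definition m2 (x : M 1) (v : V 0) : V 1 :=
  dproj 1 (module_mult phi [:: Hel x] (Hel v)).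

Definition pi_map : tens (V 0) 'Hom(V 1, K^o) -> 'Hom(M 1, K^o) :=
  tlift (fun v (xi : 'Hom(V 1, K^o)) => linfun (fun x => xi (m2 x v))).

Let m2l v : linear (m2^~ v).
Proof. by move=> c x y; rewrite /m2 module_mult2l linearP. Qed.

Let m2r x : linear (m2 x).
Proof. by move=> c v v'; rewrite /m2 module_mult2r linearP. Qed.

Let xi_m2 v (xi : 'Hom(V 1, K^o)) : linear (fun x => xi (m2 x v)).
Proof. by move=> c x y; rewrite m2l linearP. Qed.

Let pi_valE v (xi : 'Hom(V 1, K^o)) x :
  linfun (fun x => xi (m2 x v)) x = xi (m2 x v).
Proof.
pose f : {linear M 1 -> K^o} :=
  HB.pack (fun x => xi (m2 x v))
    (GRing.isLinear.Build K (M 1) K^o _ (fun x => xi (m2 x v)) (xi_m2 v xi)).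
exact: (lfunE f).
Qed.

Let pi_l xi : linear (fun v => linfun (fun x => (xi : 'Hom(V 1, K^o)) (m2 x v))).
Proof.
move=> c v v'; apply/lfunP => x.
by rewrite add_lfunE scale_lfunE !pi_valE m2r linearP.
Qed.

Let pi_r v : linear (fun xi : 'Hom(V 1, K^o) => linfun (fun x => xi (m2 x v))).
Proof.
move=> c xi xi'; apply/lfunP => x.
by rewrite add_lfunE scale_lfunE !pi_valE add_lfunE scale_lfunE.
Qed.

HB.instance Definition _ :=
  GRing.isLinear.Build K (tens (V 0) 'Hom(V 1, K^o)) 'Hom(M 1, K^o) _ pi_map
    (tlift_is_linear pi_l pi_r).

Lemma pi_mapE v xi x : pi_map (v ⊗ xi) x = xi (m2 x v).
Proof. by rewrite /pi_map (tliftE pi_l pi_r) pi_valE. Qed.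

End Pi.

(* Main.v *)
From HB Require Import structures.
From mathcomp Require Import all_boot all_order all_algebra boolp ring.
Require Import Defs.

(** Write W = M[1], so that M^1 is the part of W of degree 0.  On this part the
module structure is a formal power series on M^1 with values in Hom(V^0, V^1):
its Taylor coefficients are the operators v |-> phi(x, v), for x in the
subcoalgebra of S(W) generated by W^0.  Its linear part is, up to sign, the
linear map mu : M^1 -> Hom(V^0, V^1), x |-> m_2(x, _), and mu is dual to pi.
Injectivity of pi thus makes mu surjective, and the power series is a formal
submersion at the origin: it becomes linear in suitable formal coordinates.

These coordinates can be written down without solving any equation.  Let s be a
linear section of mu.  Take the coalgebra morphism F whose corestriction to W is
the identity on W and, on a product w of n <> 1 letters, the element
- s(v |-> phi(w, v)) of M^1 if w has degree 0, and zero otherwise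
([straighten]).  By construction phi(x, v) = phi(pr F x, v) for x of degree 0
and v in V^0, where pr is the projection onto W ([operator_straightened]).
Since F is the identity up to shorter products it is invertible
([unipotent_inverse]); with G = F^-1 this identity reads
phi(G w, v) = phi(pr w, v), which vanishes when w has at least two letters.  So
the structures transported along F, namely Q' = F Q G and
phi' = (F (x) id) phi (G (x) id), are the required ones ([transport_algebra],
[transport_module]); m_2 is unchanged because F and G fix single letters.

Most of the work is the construction of F from its corestriction f
([coalgebra_morphism_of_corestriction]).  On a word w, F is the sum, over the
partitions of w into blocks, of the products of the values of f on the blocks,
with Koszul signs.  This sum is defined for an arbitrary function h of words in
place of the product ([block_sum]), by recursion: split off the block of the
first letter, by an unshuffle of the remaining letters.  That F is well defined
and respects coproducts then follows from the coassociativity and the graded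
cocommutativity of unshuffles. *)

Set Implicit Arguments.
Unset Strict Implicit.
Unset Printing Implicit Defensive.

Import GRing.Theory.
Local Open Scope ring_scope.

(** * Unshuffles: counit, coassociativity, cocommutativity *)

Section UnshuffleCalculus.
Variables (K : fieldType) (W : int -> lmodType K).
Local Notation word := (seq (hel W)).
Local Notation sg m := ((-1 : K) ^ (m : int)).

Lemma wdeg_nil : wdeg ([::] : word) = 0.
Proof. by rewrite /wdeg big_nil. Qed.

Lemma signz_even m z : sg (m + (z + z)) = sg m.
Proof. by rewrite !signzD signzK mulr1. Qed.

Section Target.
Variable U : lmodType K.
Implicit Types g : word -> word -> U.

Lemma mask_split (m : bitseq) (w : word) : size m = size w ->
  (size (mask m w) + size (mask (map negb m) w) = size w)%N
  /\ wdeg (mask m w) + wdeg (mask (map negb m) w) = wdeg w.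
Proof.
elim: w m => [|a w IH] [|b m] //= => [_|[/IH[szE degE]]].
  by rewrite wdeg_nil addr0.
rewrite wdeg_cons -szE -degE.
by case: b; rewrite /= !wdeg_cons ?addSn ?addnS ?addrA // [_ + tag a]addrC.
Qed.

Lemma eq_unshuffle g g' w :
  (forall u v, (size u + size v = size w)%N -> wdeg u + wdeg v = wdeg w ->
     g u v = g' u v) ->
  unshuffle g w = unshuffle g' w.
Proof.
move=> e; apply: eq_bigr => m _.
by have [] := mask_split (size_tuple m); move=> sz dg; rewrite e.
Qed.

Lemma unshuffleD g g' w :
  unshuffle (fun u v => g u v + g' u v) w = unshuffle g w + unshuffle g' w.
Proof.
by rewrite /unshuffle -big_split; apply: eq_bigr => m _; rewrite scalerDr.
Qed.

Lemma unshuffleZ c g w : unshuffle (fun u v => c *: g u v) w = c *: unshuffle g w.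
Proof.
by rewrite /unshuffle scaler_sumr; apply: eq_bigr => m _; rewrite !scalerA mulrC.
Qed.

Lemma unshuffle0 w : unshuffle (fun _ _ : word => 0 : U) w = 0.
Proof. by rewrite /unshuffle big1 // => m _; rewrite scaler0. Qed.

Lemma unshuffle_counitl g w :
  unshuffle (fun u v => (u == [::])%:R *: g u v) w = g [::] w.
Proof.
elim: w g => [|a w IH] g; first by rewrite unshuffle_nil eqxx scale1r.
rewrite unshuffle_cons.
rewrite -[RHS](IH (fun u v => g u (a :: v))); apply: eq_unshuffle => u v _ _.
rewrite scale0r add0r; case: u => [|b u] /=; last by rewrite !scale0r scaler0.
by rewrite wdeg_nil mulr0 expr0z !scale1r.
Qed.

Lemma unshuffle_counitr g w :
  unshuffle (fun u v => (v == [::])%:R *: g u v) w = g w [::].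
Proof.
elim: w g => [|a w IH] g; first by rewrite unshuffle_nil eqxx scale1r.
rewrite unshuffle_cons.
rewrite -[RHS](IH (fun u v => g (a :: u) v)); apply: eq_unshuffle => u v _ _.
by rewrite scale0r scaler0 addr0.
Qed.

(** Both sides sum over the ways of distributing the letters of [w] over three
    subwords. *)
Lemma unshuffle_coassoc (g : word -> word -> word -> U) w :
  unshuffle (fun u v => unshuffle (g u) v) w =
  unshuffle (fun u v => unshuffle (fun p q => g p q v) u) w.
Proof.
elim: w g => [|a w IH] g; first by rewrite !unshuffle_nil.
rewrite !unshuffle_cons.
transitivity (unshuffle (fun u v => unshuffle (fun p q => g (a :: u) p q
  + sg (tag a * wdeg u) *: g u (a :: p) q
  + sg (tag a * (wdeg u + wdeg p)) *: g u p (a :: q)) v) w).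
  apply: eq_unshuffle => u v _ _; rewrite unshuffle_cons !unshuffleD -addrA.
  congr (_ + _); rewrite scalerDr -!unshuffleZ; congr (_ + _).
  by apply: eq_unshuffle => p q _ _; rewrite scalerA mulrDr signzD.
rewrite IH; apply: eq_unshuffle => u v _ _.
rewrite unshuffle_cons -unshuffleZ -unshuffleD.
by apply: eq_unshuffle => p q _ <-.
Qed.

(** Replacing each mask by its complement exchanges the two subwords; moving one
    past the other costs the Koszul sign. *)
Lemma unshuffle_cocomm g w :
  unshuffle g w = unshuffle (fun u v => sg (wdeg u * wdeg v) *: g v u) w.
Proof.
elim: w g => [|a w IH] g.
  by rewrite !unshuffle_nil wdeg_nil mulr0 expr0z scale1r.
rewrite !unshuffle_cons IH; apply: eq_unshuffle => u v _ _.
rewrite scalerDr addrC !wdeg_cons mulrDl mulrDr !scalerA !signzD.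
rewrite [wdeg u * tag a]mulrC mulrA signzK mul1r; congr (_ *: _ + _ *: _).
by rewrite mulrC.
Qed.

(** Meant for a subspace [P] cut out by length and degree, such as a span of
    products of words. *)
Lemma unshuffle_closed (P : U -> Prop) g w :
    P 0 -> (forall x y, P x -> P y -> P (x + y)) ->
    (forall c x, P x -> P (c *: x)) ->
    (forall u v, (size u + size v = size w)%N -> wdeg u + wdeg v = wdeg w ->
       P (g u v)) ->
  P (unshuffle g w).
Proof.
move=> P0 PD PZ Pg; rewrite /unshuffle; elim/big_ind: _ => // m _; apply: PZ.
by have [sz dg] := mask_split (size_tuple m); apply: Pg.
Qed.

(** Exactly one unshuffle has an empty left part, and its sign is trivial. *)
Lemma unshuffle_tail (P : U -> Prop) g w :
    P 0 -> (forall x y, P x -> P y -> P (x + y)) ->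
    (forall c x, P x -> P (c *: x)) ->
    (forall u v, (size u + size v = size w)%N -> wdeg u + wdeg v = wdeg w ->
       u != [::] -> P (g u v)) ->
  P (unshuffle g w - g [::] w).
Proof.
move=> P0 PD PZ Pg.
rewrite -(unshuffle_counitl g) -scaleN1r -unshuffleZ -unshuffleD.
apply: unshuffle_closed => // u v sz dg; case: eqP => [->|/eqP nu].
  by rewrite scale1r scaleN1r subrr.
by rewrite scale0r scaler0 addr0; apply: Pg.
Qed.
End Target.

Lemma unshuffle_linear (U U' : lmodType K) (L : {linear U -> U'})
    (g : word -> word -> U) w :
  L (unshuffle g w) = unshuffle (fun u v => L (g u v)) w.
Proof.
by rewrite /unshuffle linear_sum; apply: eq_bigr => m _; rewrite linearZ.
Qed.

End UnshuffleCalculus.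

(** * Sums over block partitions of a word *)

Lemma graded_symmetric_prefix (K : fieldType) (W : int -> lmodType K)
    (U : lmodType K) (h : seq (hel W) -> U) p :
  graded_symmetric h -> graded_symmetric (fun t => h (p ++ t)).
Proof.
move=> [hl hs]; split=> [u i c x y v|u a b v]; rewrite !(catA p u).
  exact: hl.
exact: hs.
Qed.

Lemma graded_symmetric_linear (K : fieldType) (W : int -> lmodType K)
    (U U' : lmodType K) (L : {linear U -> U'}) (h : seq (hel W) -> U) :
  graded_symmetric h -> graded_symmetric (fun t => L (h t)).
Proof.
move=> [hl hs]; split=> [u i c x y v|u a b v].
  by rewrite hl linearP.
by rewrite hs linearZ.
Qed.

Section Blocks.
Variables (K : fieldType) (W W' : int -> lmodType K).
Variable f : seq (hel W) -> hel W'.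
Local Notation sg m := ((-1 : K) ^ (m : int)).

(** The sum over the partitions of [w] into at most [n] blocks; the block of the
    first letter [a] is [a :: u].  Bounding the number of blocks keeps every
    truncation graded symmetric on words of any length, as needed by the
    induction in [block_sum_rec_graded_symmetric]. *)
Fixpoint block_sum_rec (n : nat) (U : lmodType K) (h : seq (hel W') -> U)
    (w : seq (hel W)) : U :=
  match w, n with
  | [::], _ => h [::]
  | _, 0%N => 0
  | a :: w', n'.+1 =>
      unshuffle (fun u v => block_sum_rec n' (fun t => h (f (a :: u) :: t)) v) w'
  end.

Definition block_sum (U : lmodType K) (h : seq (hel W') -> U)
    (w : seq (hel W)) : U :=
  block_sum_rec (size w) h w.

Section Target.
Variable U : lmodType K.
Implicit Types h : seq (hel W') -> U.

Lemma eq_block_sum_rec n h h' w :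
  h =1 h' -> block_sum_rec n h w = block_sum_rec n h' w.
Proof.
elim: n w h h' => [|n IH] [|a w] h h' e //=.
by apply: eq_unshuffle => u v _ _; apply: IH => t; apply: e.
Qed.

Lemma block_sum_recP n h h' w c :
  block_sum_rec n (fun t => c *: h t + h' t) w =
  c *: block_sum_rec n h w + block_sum_rec n h' w.
Proof.
elim: n w h h' => [|n IH] [|a w] h h' //=; first by rewrite scaler0 addr0.
rewrite -unshuffleZ -unshuffleD; apply: eq_unshuffle => u v _ _.
exact: IH.
Qed.

Lemma block_sum_rec0 n w : block_sum_rec n (fun _ => 0 : U) w = 0.
Proof.
have := block_sum_recP n (fun _ => 0) (fun _ => 0) w 1.
rewrite (@eq_block_sum_rec _ _ (fun _ => 0)) => [|t]; last by rewrite scaler0 addr0.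
by rewrite scale1r => /eqP; rewrite -subr_eq subrr eq_sym => /eqP.
Qed.

Lemma block_sum_rec_size n h w :
  (size w <= n)%N -> block_sum_rec n h w = block_sum h w.
Proof.
rewrite /block_sum; have [k] := ubnP (size w).
elim: k n w h => // k IH [|n] [|a w] h //= wk wn.
apply: eq_unshuffle => u v sz _.
have vw : (size v <= size w)%N by rewrite -sz leq_addl.
have vk : (size v < k)%N by apply: leq_ltn_trans vw wk.
by rewrite IH ?(leq_trans vw wn) // [RHS]IH.
Qed.

Lemma block_sum_cons h a w :
  block_sum h (a :: w) =
  unshuffle (fun u v => block_sum (fun t => h (f (a :: u) :: t)) v) w.
Proof.
rewrite /block_sum /=; apply: eq_unshuffle => u v sz _.
by apply: block_sum_rec_size; rewrite -sz leq_addl.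
Qed.

Lemma eq_block_sum h h' w : h =1 h' -> block_sum h w = block_sum h' w.
Proof. exact: eq_block_sum_rec. Qed.

Lemma block_sumP c h h' w :
  block_sum (fun t => c *: h t + h' t) w = c *: block_sum h w + block_sum h' w.
Proof. exact: block_sum_recP. Qed.

Lemma block_sumD h h' w :
  block_sum (fun t => h t + h' t) w = block_sum h w + block_sum h' w.
Proof.
by rewrite -[block_sum h w]scale1r -block_sumP;
  apply: eq_block_sum => t; rewrite scale1r.
Qed.

Lemma block_sum0 w : block_sum (fun _ => 0 : U) w = 0.
Proof. exact: block_sum_rec0. Qed.

Lemma block_sumZ c h w : block_sum (fun t => c *: h t) w = c *: block_sum h w.
Proof.
by rewrite -[RHS]addr0 -(block_sum0 w) -block_sumP;
  apply: eq_block_sum => t; rewrite addr0.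
Qed.

Lemma block_sum_bigsum (I : Type) (r : seq I) (c : I -> K)
    (g : I -> seq (hel W') -> U) w :
  block_sum (fun t => \sum_(i <- r) c i *: g i t) w =
  \sum_(i <- r) c i *: block_sum (g i) w.
Proof.
elim: r => [|i r IH].
  by rewrite big_nil -[RHS](block_sum0 w);
    apply: eq_block_sum => t; rewrite big_nil.
by rewrite big_cons -IH -block_sumP; apply: eq_block_sum => t; rewrite big_cons.
Qed.

Lemma block_sum_unshuffle (W0 : int -> lmodType K)
    (g : seq (hel W0) -> seq (hel W0) -> seq (hel W') -> U) w0 w :
  block_sum (fun t => unshuffle (fun p q => g p q t) w0) w =
  unshuffle (fun p q => block_sum (g p q) w) w0.
Proof. exact: block_sum_bigsum. Qed.

End Target.

Lemma block_sum_nil (U : lmodType K) (h : seq (hel W') -> U) :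
  block_sum h [::] = h [::].
Proof. by []. Qed.

Lemma block_sum_linear (U U' : lmodType K) (L : {linear U -> U'}) h w :
  L (block_sum h w) = block_sum (fun t => L (h t)) w.
Proof.
rewrite /block_sum; move: (size w) => n; elim: n w h => [|n IH] [|a w] h //=.
  by rewrite linear0.
by rewrite unshuffle_linear; apply: eq_unshuffle => u v _ _; apply: IH.
Qed.

Lemma block_sum_counit (U : lmodType K) (x : U) w :
  block_sum (fun t => (t == [::])%:R *: x) w = (w == [::])%:R *: x.
Proof.
case: w => [//|a w]; transitivity (unshuffle (fun _ _ : seq (hel W) => 0 : U) w).
  rewrite block_sum_cons; apply: eq_unshuffle => u v _ _; rewrite -(block_sum0 U v).
  by apply: eq_block_sum => t; rewrite scale0r.
by rewrite unshuffle0 scale0r.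
Qed.

(** A function supported on one-letter words only sees the partition into a
    single block. *)
Lemma block_sum_corestriction (U : lmodType K) (g : hel W' -> U) w :
  block_sum (fun t => if t is [:: x] then g x else 0) w =
  if w is [::] then 0 else g (f w).
Proof.
case: w => [//|a w]; rewrite block_sum_cons.
rewrite -(unshuffle_counitr (fun u v => g (f (a :: u)))).
apply: eq_unshuffle => u v _ _; rewrite -block_sum_counit; apply: eq_block_sum.
by case=> [|b t]; rewrite ?scale1r ?scale0r.
Qed.

Hypothesis f_deg : forall w, tag (f w) = wdeg w.

(** As [f] preserves degrees, only words of the degree of [w] occur in the
    sum. *)
Lemma eq_block_sum_deg (U : lmodType K) (h h' : seq (hel W') -> U) w :
  (forall t, wdeg t = wdeg w -> h t = h' t) -> block_sum h w = block_sum h' w.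
Proof.
have [k] := ubnP (size w); elim: k w h h' => // k IH [|a w] h h' /= wk e.
  by rewrite !block_sum_nil e // !wdeg_nil.
rewrite !block_sum_cons; apply: eq_unshuffle => u v sz dg; apply: IH => [|t dt].
  by rewrite (leq_trans _ (wk : (size w < k)%N)) // ltnS -sz leq_addl.
by apply: e; rewrite wdeg_cons f_deg !wdeg_cons dt -addrA dg.
Qed.

Lemma block_sum_sign (U : lmodType K) (h : seq (hel W') -> U) w m :
  block_sum (fun t => sg (m * wdeg t) *: h t) w = sg (m * wdeg w) *: block_sum h w.
Proof. by rewrite -block_sumZ; apply: eq_block_sum_deg => t ->. Qed.

(** Distributing the blocks of a partition of [w] over two words amounts to
    distributing the letters of [w] over two words, and then partitioning each.
    For [k u v := vee u ⊗ vee v] this says that the extension of [f] is a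
    morphism of coalgebras. *)
Lemma block_sum_of_unshuffle (U : lmodType K)
    (k : seq (hel W') -> seq (hel W') -> U) w :
  block_sum (unshuffle k) w =
  unshuffle (fun u v => block_sum (fun p => block_sum (k p) v) u) w.
Proof.
have [n] := ubnP (size w); elim: n w k => // n IH [|a w] k /= wn.
  by rewrite block_sum_nil !unshuffle_nil !block_sum_nil.
rewrite block_sum_cons unshuffle_cons.
pose A u u1 v := block_sum (fun p => block_sum (k (f (a :: u) :: p)) v) u1.
pose B u v1 v :=
  block_sum (fun p => block_sum (fun q => k p (f (a :: v1) :: q)) v) u.
transitivity (unshuffle (fun u v => unshuffle (fun p q =>
    A u p q + sg ((tag a + wdeg u) * wdeg p) *: B p u q) v) w).
  apply: eq_unshuffle => u v sz _.
  transitivity (block_sum (unshuffle (fun p q => k (f (a :: u) :: p) q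
      + sg ((tag a + wdeg u) * wdeg p) *: k p (f (a :: u) :: q))) v).
    apply: eq_block_sum => t; rewrite unshuffle_cons f_deg wdeg_cons.
    by apply: eq_unshuffle.
  rewrite IH; last first.
    by rewrite (leq_trans _ (wn : (size w < n)%N)) // ltnS -sz leq_addl.
  apply: eq_unshuffle => p q _ _; rewrite /A /B -block_sum_sign -block_sumD.
  by apply: eq_block_sum => t; rewrite -block_sumZ -block_sumD.
have split_sum u v : unshuffle (fun p q =>
      A u p q + sg ((tag a + wdeg u) * wdeg p) *: B p u q) v =
    unshuffle (A u) v
    + unshuffle (fun p q => sg ((tag a + wdeg u) * wdeg p) *: B p u q) v.
  by rewrite unshuffleD.
rewrite (eq_unshuffle (fun u v _ _ => split_sum u v)) !unshuffleD; congr (_ + _).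
  rewrite unshuffle_coassoc; apply: eq_unshuffle => u v _ _.
  by rewrite block_sum_cons.
rewrite unshuffle_coassoc.
transitivity (unshuffle (fun u v => unshuffle (fun p q =>
    sg (tag a * wdeg p) *: B p q v) u) w).
  apply: eq_unshuffle => u v _ _; rewrite unshuffle_cocomm.
  apply: eq_unshuffle => p q _ _.
  rewrite scalerA -signzD mulrDl addrCA [wdeg q * _]mulrC.
  by rewrite signzD signzD signzK mulr1.
rewrite -(unshuffle_coassoc (fun p q v => sg (tag a * wdeg p) *: B p q v)).
apply: eq_unshuffle => u v _ _; rewrite unshuffleZ; congr (_ *: _).
rewrite -block_sum_unshuffle; apply: eq_block_sum => t.
by rewrite block_sum_cons.
Qed.

Hypothesis f_sym : graded_symmetric (fun w => din (f w)).

(** A function linear in its first letter factors through the direct sum, where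
    the graded symmetry of [f] is stated. *)
Lemma graded_symmetric_letter (U : lmodType K) (h : seq (hel W') -> U) t :
  graded_symmetric h -> graded_symmetric (fun w => h (f w :: t)).
Proof.
move=> [hl hs].
have lin i : linear (fun x : W' i => h (Hel x :: t)).
  by move=> c x y; apply: (hl [::]).
pose g x := h (x :: t).
pose L : {linear dsum W' -> U} :=
  HB.pack (dlift g) (GRing.isLinear.Build K _ _ _ (dlift g) (dlift_is_linear lin)).
have hE w : h (f w :: t) = L (din (f w)) by rewrite /= (dliftE lin).
have [Ll Ls] := graded_symmetric_linear L f_sym.
split=> [u i c x y v|u a b v]; rewrite !hE.
  exact: Ll.
exact: Ls.
Qed.

Lemma graded_symmetric_block_sum_family (W0 : int -> lmodType K) (U : lmodType K)
    (g : seq (hel W0) -> seq (hel W') -> U) n w :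
  (forall t, graded_symmetric (g^~ t)) ->
  graded_symmetric (fun u => block_sum_rec n (g u) w).
Proof.
move=> gs; split=> [u i c x y v|u a b v].
  by rewrite -block_sum_recP; apply: eq_block_sum_rec => t; apply: (gs t).1.
rewrite -[RHS]addr0 -(block_sum_rec0 _ n w) -block_sum_recP.
apply: eq_block_sum_rec => t.
by rewrite addr0; apply: (gs t).2.
Qed.

(** For two adjacent letters at the head of the word, the partitions where they
    share a block are handled by the symmetry of [f], and those where they lie
    in the two different leading blocks by the symmetry of [h] together with an
    exchange of these two blocks.  Letters further in are handled by the
    symmetry of unshuffles. *)
Lemma block_sum_rec_graded_symmetric n (U : lmodType K) (h : seq (hel W') -> U) :
  graded_symmetric h -> graded_symmetric (block_sum_rec n h).
Proof.
elim: n h => [|n IH] h gs.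
  by split=> [[|? ?] i c x y v|[|? ?] a b v] /=; rewrite ?scaler0 ?addr0.
pose g a u v := block_sum_rec n (fun t => h (f (a :: u) :: t)) v.
have g_sym a : (forall v, graded_symmetric ((g a)^~ v)) /\
               (forall u, graded_symmetric (g a u)).
  split=> [v|u].
    apply: graded_symmetric_block_sum_family => t.
    apply: (graded_symmetric_prefix (h := fun u => h (f u :: t)) [:: a]).
    exact: graded_symmetric_letter.
  by apply: IH; apply: (graded_symmetric_prefix [:: f (a :: u)]).
(* the partitions with [a] and [b] in different blocks *)
have swap_letters a b w :
    unshuffle (fun u v => sg (tag b * wdeg u) *:
      block_sum_rec n (fun t => h (f (a :: u) :: t)) (b :: v)) w =
    sg (tag a * tag b) *: unshuffle (fun u v => sg (tag a * wdeg u) *: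
      block_sum_rec n (fun t => h (f (b :: u) :: t)) (a :: v)) w.
  case: (n) => [|k] /=.
    rewrite -unshuffleZ; apply: eq_unshuffle => u v _ _.
    by rewrite !scaler0.
  pose X x u y p q :=
    block_sum_rec k (fun t => h (f (x :: u) :: f (y :: p) :: t)) q.
  have regroup x y : unshuffle (fun u v => sg (tag y * wdeg u) *:
        unshuffle (X x u y) v) w =
      unshuffle (fun r q => unshuffle (fun u p =>
        sg (tag y * wdeg u) *: X x u y p q) r) w.
    rewrite -(unshuffle_coassoc (fun u p q => sg (tag y * wdeg u) *: X x u y p q)).
    by apply: eq_unshuffle => u v _ _; rewrite unshuffleZ.
  rewrite (regroup a b) (regroup b a) -unshuffleZ; apply: eq_unshuffle => r q _ _.
  rewrite [in RHS]unshuffle_cocomm -unshuffleZ; apply: eq_unshuffle => u p _ _.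
  have -> : X b p a u q =
      sg ((tag b + wdeg p) * (tag a + wdeg u)) *: X a u b p q.
    rewrite -[RHS]addr0 -(block_sum_rec0 U k q) -block_sum_recP.
    apply: eq_block_sum_rec => t.
    by rewrite addr0 (gs.2 [::]) !f_deg !wdeg_cons.
  rewrite !scalerA -!signzD; congr (_ *: _).
  rewrite -(signz_even K (tag b * wdeg u)
    (tag a * tag b + wdeg u * wdeg p + tag a * wdeg p)).
  by congr (_ ^ _); ring.
have letter_sym u v := graded_symmetric_block_sum_family n v
  (fun t => graded_symmetric_prefix u (graded_symmetric_letter t gs)).
split=> [[|d u] i c x y v|[|d u] a b v] /=.
- rewrite -unshuffleZ -unshuffleD; apply: eq_unshuffle => p q _ _.
  exact: (letter_sym [::] q).1 [::] i c x y p.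
- have [gl gr] := g_sym d.
  exact: (unshuffle_graded_symmetric gl gr).1.
- rewrite !unshuffle_cons !unshuffleD scalerDr; congr (_ + _).
    rewrite -unshuffleZ; apply: eq_unshuffle => p q _ _.
    exact: (letter_sym [::] q).2 [::] a b p.
  exact: swap_letters.
- have [gl gr] := g_sym d.
  exact: (unshuffle_graded_symmetric gl gr).2.
Qed.

Lemma block_sum_graded_symmetric (U : lmodType K) (h : seq (hel W') -> U) :
  graded_symmetric h -> graded_symmetric (block_sum h).
Proof.
move=> gs; split=> [u i c x y v|u a b v]; rewrite /block_sum.
  rewrite !size_cat /=; exact: (block_sum_rec_graded_symmetric _ gs).1.
rewrite !size_cat /=; exact: (block_sum_rec_graded_symmetric _ gs).2.
Qed.

End Blocks.

(** * Linear maps on presented spaces *)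

Section SpanFacts.
Variables (K : fieldType) (V V' : lmodType K).

Lemma span_linear (R : V -> Prop) (R' : V' -> Prop) (L : {linear V -> V'}) x :
  (forall r, R r -> span R' (L r)) -> span R x -> span R' (L x).
Proof.
move=> RR'; elim=> [|a r y Rr _ IH]; first by rewrite linear0; apply: span0.
by rewrite linearP; apply: spanD => //; apply/spanZ/RR'.
Qed.

Lemma spanN (R : V -> Prop) x : span R x -> span R (- x).
Proof. by move=> Rx; rewrite -scaleN1r; apply: spanZ. Qed.

End SpanFacts.

Lemma span_sub (K : fieldType) (V : lmodType K) (R R' : V -> Prop) x :
  (forall r, R r -> span R' r) -> span R x -> span R' x.
Proof. exact: (span_linear (L := idfun)). Qed.

Lemma pack_linear (K : fieldType) (A B : lmodType K) (g : A -> B) :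
  linear g -> exists L : {linear A -> B}, L =1 g.
Proof.
move=> lin_g.
by exists (HB.pack g (GRing.isLinear.Build K A B _ g lin_g) : {linear A -> B}).
Qed.

Section TensorFacts.
Variables (K : fieldType) (A B : lmodType K).

Lemma linear_tensorl (b : B) :
  exists L : {linear A -> tens A B}, L =1 (fun a => a ⊗ b).
Proof. by apply: pack_linear => c x y; rewrite tpureDl. Qed.

Lemma linear_tensorr (a : A) :
  exists L : {linear B -> tens A B}, L =1 (fun b => a ⊗ b).
Proof. by apply: pack_linear => c x y; rewrite tpureDr. Qed.

Lemma eq_linear_tens (U : lmodType K) (L L' : {linear tens A B -> U}) :
  (forall a b, L (a ⊗ b) = L' (a ⊗ b)) -> L =1 L'.
Proof.
move=> e x; elim/tens_ind: x => [|c a b x IH]; first by rewrite !linear0.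
by rewrite !linearP e IH.
Qed.
End TensorFacts.

Lemma eq_linear_rsym (K : fieldType) (W : int -> lmodType K) (U : lmodType K)
    (L L' : {linear rsym W -> U}) :
  (forall w, L (vee w) = L' (vee w)) -> L =1 L'.
Proof.
move=> e x; elim/rsym_ind: x => [|c w x IH]; first by rewrite !linear0.
by rewrite !linearP e IH.
Qed.

(** * Coalgebra morphisms with a given corestriction *)

Section BlockBounds.
Variables (K : fieldType) (W W' : int -> lmodType K).
Variable f : seq (hel W) -> hel W'.
Hypothesis f_deg : forall w, tag (f w) = wdeg w.

Lemma block_sum_closed (U : lmodType K) (P : U -> Prop) h w :
    P 0 -> (forall x y, P x -> P y -> P (x + y)) ->
    (forall c x, P x -> P (c *: x)) ->
    (forall t, (size t <= size w)%N -> wdeg t = wdeg w -> P (h t)) ->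
  P (block_sum f h w).
Proof.
move=> P0 PD PZ; have [n] := ubnP (size w).
elim: n w h => // n IH [|a w] h /= wn Ph.
  by rewrite block_sum_nil; apply: Ph; rewrite ?wdeg_nil.
rewrite block_sum_cons; apply: (unshuffle_closed (P := P)) => // u v sz dg.
have vw : (size v <= size w)%N by rewrite -sz leq_addl.
apply: IH => [|t tv dt]; first exact: leq_ltn_trans vw _.
apply: Ph => /=; first exact: leq_trans tv vw.
by rewrite wdeg_cons f_deg !wdeg_cons dt -addrA dg.
Qed.

End BlockBounds.

(** The partition into singletons contributes [h w] itself, and every other
    partition a word with fewer letters. *)
Lemma block_sum_leading_term (K : fieldType) (W : int -> lmodType K)
    (f : seq (hel W) -> hel W) (U : lmodType K) (P : U -> Prop) h w :
    (forall w, tag (f w) = wdeg w) -> (forall a, f [:: a] = a) ->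
    P 0 -> (forall x y, P x -> P y -> P (x + y)) ->
    (forall c x, P x -> P (c *: x)) ->
    (forall t, (size t < size w)%N -> wdeg t = wdeg w -> P (h t)) ->
  P (block_sum f h w - h w).
Proof.
move=> f_deg f1 P0 PD PZ; elim: w h => [|a w IH] h Ph.
  by rewrite block_sum_nil subrr.
rewrite block_sum_cons.
pose g u v := block_sum f (fun t => h (f (a :: u) :: t)) v.
rewrite -[unshuffle _ w](subrK (g [::] w)) -addrA; apply: (PD).
  apply: (unshuffle_tail (P := P) (g := g)) => // u v sz dg u_neq0.
  apply: (block_sum_closed f_deg (P := P)) => // t tv dt; apply: Ph.
    rewrite /= ltnS -sz (leq_ltn_trans tv) // -[X in (X < _)%N]add0n ltn_add2r.
    by case: (u) u_neq0.
  by rewrite wdeg_cons f_deg !wdeg_cons dt -addrA dg.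
rewrite /g f1; apply: (IH (fun t => h (a :: t))) => t tw dt.
by apply: Ph; rewrite //= !wdeg_cons dt.
Qed.

(** The existence half of the universal property of the cofree coalgebra
    [rsym W']. *)
Theorem coalgebra_morphism_of_corestriction (K : fieldType)
    (W W' : int -> lmodType K) (f : seq (hel W) -> hel W') :
    (forall w, tag (f w) = wdeg w) -> graded_symmetric (fun w => din (f w)) ->
  exists F : {linear rsym W -> rsym W'},
    [/\ forall w, F (vee w) = block_sum f vee w,
        has_degree (@shomog K W) (@shomog K W') 0 F,
        forall x, coprod (F x) = tmap F F (coprod x)
      & forall w, slin (F (vee w)) = if w is [::] then 0 else din (f w)].
Proof.
move=> f_deg f_sym.
have B_sym := block_sum_graded_symmetric f_deg f_sym (vee_graded_symmetric W').
have B_nil : block_sum f vee [::] = 0 by rewrite block_sum_nil vee_nil.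
have [F FE] := pack_linear (slift_is_linear B_sym B_nil).
have {FE} FE w : F (vee w) = block_sum f vee w by rewrite FE sliftE.
exists F; split=> // [d x|x|w].
- rewrite addr0; apply: span_linear => _ [w dw ->]; rewrite FE.
  apply: block_sum_closed => //;
    [exact: span0|exact: spanD|by move=> *; exact: spanZ|].
  by move=> t _ dt; apply: span_gen; exists t; rewrite ?dt.
- apply: (eq_linear_rsym (L := coprod \o F) (L' := tmap F F \o coprod)) => w /=.
  rewrite coprodE FE !(block_sum_linear, unshuffle_linear).
  transitivity (block_sum f (unshuffle (fun u v => vee u ⊗ vee v)) w).
    by apply: eq_block_sum => t; apply: coprodE.
  rewrite block_sum_of_unshuffle //; apply: eq_unshuffle => u v _ _.
  rewrite /= tmapE !FE; have [L LE] := linear_tensorl (rsym W') (block_sum f vee v).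
  rewrite -LE block_sum_linear; apply: eq_block_sum => t; rewrite LE.
  have [L' L'E] := linear_tensorr (rsym W') (vee t).
  by rewrite -L'E block_sum_linear; apply: eq_block_sum => t'; rewrite L'E.
- rewrite FE block_sum_linear -(block_sum_corestriction f din).
  by apply: eq_block_sum => t; rewrite /= slinE.
Qed.

(** [F - id] strictly lowers the filtration by the number of letters, which is
    exhaustive and starts at zero; it is therefore locally nilpotent. *)
Theorem unipotent_inverse (K : fieldType) (W : int -> lmodType K)
    (F : {linear rsym W -> rsym W}) :
    (forall w, span (fun x => exists t, [/\ (size t < size w)%N, wdeg t = wdeg w
                                          & x = vee t]) (F (vee w) - vee w)) ->
  exists G : {linear rsym W -> rsym W},
    [/\ cancel F G, cancel G F & has_degree (@shomog K W) (@shomog K W) 0 G].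
Proof.
move=> F_lead.
pose filt n := span (fun x : rsym W => exists2 t, (size t < n)%N & x = vee t).
have filt_step n x : filt n.+1 x -> filt n (F x - x).
  pose N : {linear rsym W -> rsym W} := F \- idfun.
  apply: (span_linear (L := N)) => _ [t tn ->]; apply: span_sub (F_lead t).
  by move=> _ [p [pt _ ->]]; apply: span_gen; exists p; rewrite // (leq_trans pt).
have filt_all x : exists n, filt n x.
  elim/rsym_ind: x => [|c w x [n xn]]; first by exists 0%N; apply: span0.
  exists (maxn n (size w).+1); apply: spanD.
    by apply/spanZ/span_gen; exists w; rewrite // leq_max leqnn orbT.
  apply: span_sub xn => _ [t tn ->]; apply: span_gen; exists t => //.
  by rewrite leq_max tn.
have F_ker x : F x = 0 -> x = 0.
  have [n] := filt_all x; elim: n => [|n IH] xn Fx0.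
    by elim: xn => // a r y [].
  have := spanN (filt_step _ _ xn); rewrite Fx0 sub0r opprK => x_short.
  exact: IH.
have F_inj : injective F.
  move=> x y Fxy; apply/eqP; rewrite -subr_eq0; apply/eqP/F_ker.
  by rewrite linearB Fxy subrr.
(* Induction on the length: [F] maps [vee w] to itself up to shorter products,
   which already have homogeneous preimages. *)
have F_onto w : exists2 y, shomog (wdeg w) y & F y = vee w.
  have [n] := ubnP (size w); elim: n w => // n IH w wn.
  suff [y yd Fy] : exists2 y, shomog (wdeg w) y & F y = F (vee w) - vee w.
    exists (vee w - y); last by rewrite linearB Fy subKr.
    by apply: spanD; [apply: span_gen; exists w | apply: spanN].
  elim: (F_lead w) => [|a _ x [t [tw <- ->]] _ [y yd <-]].
    by exists 0; rewrite ?linear0 //; apply: span0.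
  have [z zd Fz] := IH t (leq_trans tw wn).
  by exists (a *: z + y); [apply: spanD => //; apply: spanZ | rewrite linearP Fz].
have F_onto_homog d x : shomog d x -> exists2 y, shomog d y & F y = x.
  elim=> [|a _ z [w <- ->] _ [y yd <-]].
    by exists 0; rewrite ?linear0 //; apply: span0.
  have [t td Ft] := F_onto w.
  by exists (a *: t + y); [apply: spanD => //; apply: spanZ | rewrite linearP Ft].
have F_surj x : exists y, F y = x.
  elim/rsym_ind: x => [|a w _ [y <-]]; first by exists 0; rewrite linear0.
  by have [t _ <-] := F_onto w; exists (a *: t + y); rewrite linearP.
have [g FgK] := choice F_surj.
have [G GE] : exists G : {linear rsym W -> rsym W}, G =1 g.
  by apply: pack_linear => c x y; apply: F_inj; rewrite linearP !FgK.
exists G; split=> [x|x|d x xd]; rewrite GE ?FgK //.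
  by apply: F_inj; rewrite FgK.
have [y yd <-] := F_onto_homog d x xd.
have -> : g (F y) = y by apply: F_inj; rewrite FgK.
by rewrite addr0.
Qed.

(** * Transport of algebra structures *)

Lemma tmap_comp (K : fieldType) (A B A1 B1 A2 B2 : lmodType K)
    (f : {linear A -> A1}) (g : {linear B -> B1})
    (f' : {linear A1 -> A2}) (g' : {linear B1 -> B2}) x :
  tmap f' g' (tmap f g x) = tmap (f' \o f) (g' \o g) x.
Proof.
apply: (eq_linear_tens (L := tmap f' g' \o tmap f g)
  (L' := tmap (f' \o f) (g' \o g))).
by move=> a b /=; rewrite !tmapE.
Qed.

Lemma eq_tmap (K : fieldType) (A B A1 B1 : lmodType K)
    (f f' : {linear A -> A1}) (g g' : {linear B -> B1}) :
  f =1 f' -> g =1 g' -> tmap f g =1 tmap f' g'.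
Proof.
move=> ef eg; apply: (eq_linear_tens (L := tmap f g) (L' := tmap f' g')) => a b.
by rewrite /= !tmapE ef eg.
Qed.

Lemma tmap_id (K : fieldType) (A B : lmodType K) (x : tens A B) :
  tmap idfun idfun x = x.
Proof.
apply: (eq_linear_tens (L := tmap idfun idfun) (L' := idfun)) => a b.
exact: tmapE.
Qed.

Lemma parity_shomog (K : fieldType) (W : int -> lmodType K) d (x : rsym W) :
  shomog d x -> parity x = (-1) ^ d *: x.
Proof.
elim=> [|a _ y [w <- ->] _ IH]; first by rewrite linear0 scaler0.
by rewrite linearP /= parityE IH scalerDr !scalerA mulrC.
Qed.

(** This lets the Koszul sign of [id ⊗ Q] pass through a morphism of degree 0. *)
Lemma parity_commute (K : fieldType) (W W' : int -> lmodType K)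
    (F : {linear rsym W -> rsym W'}) :
  has_degree (@shomog K W) (@shomog K W') 0 F ->
  forall x, parity (F x) = F (parity x).
Proof.
move=> F_deg.
apply: (eq_linear_rsym (L := parity \o F) (L' := F \o parity)) => w /=.
rewrite parityE linearZ; apply: parity_shomog; rewrite -[wdeg w]addr0.
by apply: F_deg; apply: span_gen; exists w.
Qed.

Lemma inverse_coalgebra_morphism (K : fieldType) (W W' : int -> lmodType K)
    (F : {linear rsym W -> rsym W'}) (G : {linear rsym W' -> rsym W}) :
    cancel F G -> cancel G F -> (forall x, coprod (F x) = tmap F F (coprod x)) ->
  forall y, coprod (G y) = tmap G G (coprod y).
Proof.
move=> FK GK F_co y; rewrite -{2}[y]GK F_co tmap_comp.
rewrite (eq_tmap (f' := idfun) (g' := idfun)) //.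
by rewrite tmap_id.
Qed.

Theorem transport_algebra (K : fieldType) (L L' : int -> lmodType K)
    (Q : {linear rsym (shift L) -> rsym (shift L)})
    (F : {linear rsym (shift L) -> rsym (shift L')})
    (G : {linear rsym (shift L') -> rsym (shift L)}) :
    Linfty_algebra Q -> cancel F G -> cancel G F ->
    has_degree (@shomog K (shift L)) (@shomog K (shift L')) 0 F ->
    has_degree (@shomog K (shift L')) (@shomog K (shift L)) 0 G ->
    (forall x, coprod (F x) = tmap F F (coprod x)) ->
  Linfty_algebra (F \o Q \o G) /\ Linfty_iso Q (F \o Q \o G) F G.
Proof.
move=> [Q_deg Q_co QQ] FK GK F_deg G_deg F_co.
have G_co := inverse_coalgebra_morphism FK GK F_co.
split; last by split=> //; split=> // x /=; rewrite ?FK ?GK.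
split=> [d x xd|x|x] /=; last by rewrite FK QQ linear0.
  by rewrite -[d + 1]addr0; apply/F_deg/Q_deg; rewrite -[d]addr0; apply: G_deg.
rewrite F_co Q_co G_co linearD /= !tmap_comp; congr (_ + _).
  by apply: eq_tmap => y /=; rewrite ?GK.
by apply: eq_tmap => y //=; rewrite -parity_commute //= GK.
Qed.

(** * The coproduct of the coalgebra with counit *)

Section FullCoproduct.
Variables (K : fieldType) (W : int -> lmodType K).
Local Notation one := (svee [::] : sym W).

Definition sym_incl (x : rsym W) : sym W := (0, x).

Lemma sym_incl_is_linear : linear sym_incl.
Proof. by move=> c x y; congr pair; rewrite [RHS]addr0 [RHS]scaler0. Qed.

HB.instance Definition _ :=
  GRing.isLinear.Build K (rsym W) (sym W) _ sym_incl sym_incl_is_linear.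

Lemma sym_split (s : sym W) : s = (s.1 : K) *: one + sym_incl s.2.
Proof.
case: s => c x; rewrite /sym_incl /svee /= vee_nil; congr pair.
  by rewrite [RHS]addr0 [RHS]mulr1.
by rewrite [X in _ = X + _](scaler0 (rsym W) (c : K)) [RHS]add0r.
Qed.

Lemma svee_split w : svee w = (w == [::])%:R *: one + sym_incl (vee w).
Proof. by rewrite {1}[svee w]sym_split. Qed.

Lemma eq_linear_sym (U : lmodType K) (L L' : {linear sym W -> U}) :
  (forall w, L (svee w) = L' (svee w)) -> L =1 L'.
Proof.
move=> e s; rewrite [s]sym_split !linearP e; congr (_ + _).
apply: (eq_linear_rsym (L := L \o sym_incl) (L' := L' \o sym_incl)) => [[|a w]] /=.
  by rewrite vee_nil !linear0.
exact: (e (a :: w)).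
Qed.

(** The module formula sums over all unshuffles, including those with an empty
    part, so it is governed by the coproduct of K (+) rsym W: the reduced one
    plus the terms 1 ⊗ x + x ⊗ 1. *)
Definition full_coprod (s : sym W) : tens (sym W) (sym W) :=
  (s.1 : K) *: (one ⊗ one) + sym_incl s.2 ⊗ one + one ⊗ sym_incl s.2
  + tmap sym_incl sym_incl (coprod s.2).

Lemma tpureDD (A B : lmodType K) (a a' : A) (b b' : B) c c' :
  (c *: a + a') ⊗ (c' *: b + b') =
  c *: (c' *: (a ⊗ b)) + c *: (a ⊗ b') + c' *: (a' ⊗ b) + a' ⊗ b'.
Proof. by rewrite tpureDl !tpureDr scalerDr !addrA. Qed.

Lemma full_coprod_is_linear : linear full_coprod.
Proof.
move=> c x y; rewrite /full_coprod.
rewrite -[(c *: x + y).1]/((c : K) * x.1 + y.1) -[(c *: x + y).2]/(c *: x.2 + y.2).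
rewrite scalerDl -scalerA (linearP (sym_incl : {linear _ -> _})) tpureDl tpureDr.
rewrite (linearP (coprod : {linear _ -> _})) (linearP (tmap _ _ : {linear _ -> _})).
rewrite 3!(scalerDr c).
have shuffle (a b d e a' b' d' e' : tens (sym W) (sym W)) :
    (a + a') + (b + b') + (d + d') + (e + e')
    = (a + b + d + e) + (a' + b' + d' + e').
  by rewrite (addrACA a) (addrACA (a + b)) (addrACA (a + b + d)).
exact: shuffle.
Qed.

HB.instance Definition _ :=
  GRing.isLinear.Build K _ _ _ full_coprod full_coprod_is_linear.

Lemma full_coprodE w :
  full_coprod (svee w) = unshuffle (fun u v => svee u ⊗ svee v) w.
Proof.
pose g (u v : seq (hel W)) := (u == [::])%:R *: ((v == [::])%:R *: (one ⊗ one))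
  + (u == [::])%:R *: (one ⊗ sym_incl (vee v))
  + (v == [::])%:R *: (sym_incl (vee u) ⊗ one)
  + sym_incl (vee u) ⊗ sym_incl (vee v).
transitivity (unshuffle g w); last first.
  by apply: eq_unshuffle => u v _ _; rewrite (svee_split u) (svee_split v) tpureDD.
rewrite !unshuffleD !unshuffle_counitl unshuffle_counitr /full_coprod /=.
rewrite coprodE unshuffle_linear -!addrA; congr (_ + _).
rewrite addrCA; do 2!congr (_ + _).
by apply: eq_unshuffle => u v _ _; rewrite /= tmapE.
Qed.

End FullCoproduct.

Lemma ext1_one (K : fieldType) (W W' : int -> lmodType K)
    (F : {linear rsym W -> rsym W'}) : ext1 F (svee [::]) = svee [::].
Proof. by rewrite /ext1 /svee /= !vee_nil linear0. Qed.

Lemma full_coprod_ext1 (K : fieldType) (W W' : int -> lmodType K)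
    (F : {linear rsym W -> rsym W'}) :
    (forall x, coprod (F x) = tmap F F (coprod x)) ->
  forall s, full_coprod (ext1 F s) = tmap (ext1 F) (ext1 F) (full_coprod s).
Proof.
move=> F_co s; rewrite /full_coprod.
have incl1 x : ext1 F (sym_incl x) = sym_incl (F x) by [].
rewrite 3!(linearD (tmap (ext1 F) (ext1 F))) linearZ_LR.
rewrite /= !tmapE /= ext1_one !incl1; congr (_ + _); rewrite F_co !tmap_comp.
exact: eq_tmap.
Qed.

(** * Transport of module structures *)

Section ModuleFormula.
Variables (K : fieldType) (L V : int -> lmodType K).
Local Notation S := (rsym (shift L)).
Local Notation SV := (tens (sym (shift L)) (dsum V)).

Lemma ext1_parity w :
  ext1 parity (svee w) = (-1) ^ wdeg w *: svee w :> sym (shift L).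
Proof.
rewrite /ext1 /svee /= parityE; congr pair.
case: w => [|a w] /=; last by rewrite [RHS]mulr0.
by rewrite wdeg_nil expr0z [RHS]mul1r.
Qed.

(** The map s ⊗ s' |-> (-1)^|s| s ⊗ phi(s', v). *)
Definition action_on (phi : {linear SV -> SV}) (v : dsum V)
    (t : tens (sym (shift L)) (sym (shift L))) : SV :=
  tlift (fun s s' => ext1 parity s ⊗ component phi (s' ⊗ v)) t.

Variable phi : {linear SV -> SV}.

Let action_l v s' :
  linear (fun s : sym (shift L) => ext1 parity s ⊗ component phi (s' ⊗ v)).
Proof. by move=> c x y; rewrite linearP tpureDl. Qed.

Let action_r v (s : sym (shift L)) :
  linear (fun s' : sym (shift L) => ext1 parity s ⊗ component phi (s' ⊗ v)).
Proof. by move=> c x y; rewrite tpureDl /component !linearP tpureDr. Qed.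

Lemma action_on_is_linear v : linear (action_on phi v).
Proof. exact: tlift_is_linear (action_l v) (action_r v). Qed.

HB.instance Definition _ v :=
  GRing.isLinear.Build K (tens (sym (shift L)) (sym (shift L))) SV _
    (action_on phi v) (action_on_is_linear v).

Lemma action_onE v (s s' : sym (shift L)) :
  action_on phi v (s ⊗ s') = ext1 parity s ⊗ component phi (s' ⊗ v).
Proof. exact: (tliftE (action_l v) (action_r v)). Qed.

Lemma action_on_coprod v w :
  action_on phi v (full_coprod (svee w)) =
  unshuffle (fun u u' => (-1) ^ wdeg u *:
    (svee u ⊗ component phi (svee u' ⊗ v))) w.
Proof.
rewrite full_coprodE (unshuffle_linear (action_on phi v)).
apply: eq_unshuffle => u u' _ _ /=.
by rewrite action_onE ext1_parity tpureZl.
Qed.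

(** The formula that recovers [phi] from its components, freed from words: in
    this form it can be conjugated by morphisms of coalgebras. *)
Lemma module_formula (Q : {linear S -> S}) : Linfty_module Q phi ->
  forall (v : hel V) s,
    phi (s ⊗ din v) = ext0 Q s ⊗ din v + action_on phi (din v) (full_coprod s).
Proof.
move=> [_ _ phiE] v s.
have [Lv LvE] := linear_tensorl (sym (shift L)) (din v).
have e := eq_linear_sym (L := phi \o Lv)
  (L' := (Lv \o ext0 Q) \+ (action_on phi (din v) \o full_coprod (W := shift L))).
have := e _ s; rewrite /= !LvE; apply=> w /=.
by rewrite !LvE action_on_coprod phiE.
Qed.

End ModuleFormula.

Lemma SVhomog_incl (K : fieldType) (L V : int -> lmodType K) d
    (x : rsym (shift L)) (v : hel V) :
  shomog d x -> SVhomog (d + tag v) (sym_incl x ⊗ din v).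
Proof.
have [Lv LvE] := linear_tensorl (sym (shift L)) (din v).
rewrite -LvE; apply: (span_linear (L := Lv \o sym_incl (W := shift L))).
move=> _ [t <- ->] /=; rewrite LvE; case: t => [|b t].
  by rewrite vee_nil linear0 tpure0l; apply: span0.
by apply: span_gen; exists (b :: t, v).
Qed.

Section TransportModule.
Variables (K : fieldType) (L L' V : int -> lmodType K).
Variable F : {linear rsym (shift L) -> rsym (shift L')}.

Lemma SVhomog_ext1 :
  has_degree (@shomog K (shift L)) (@shomog K (shift L')) 0 F ->
  has_degree (@SVhomog K L V) (@SVhomog K L' V) 0 (tmap (ext1 F) idfun).
Proof.
move=> F_deg d x; rewrite addr0; apply: span_linear => _ [[w v] /= wv ->].
rewrite /= tmapE /=; case: w wv => [|a w] wv.
  apply: span_gen; exists ([::], v); last by rewrite ext1_one.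
  by rewrite /= wdeg_nil -(wdeg_nil (shift L)).
rewrite -[ext1 F _]/(sym_incl (F (vee (a :: w)))) -wv; apply: SVhomog_incl.
by rewrite -[wdeg _]addr0; apply: F_deg; apply: span_gen; exists (a :: w).
Qed.

Lemma SVproj_ext1 x : SVproj (tmap (ext1 F) idfun x) = SVproj (x : tens _ (dsum V)).
Proof.
apply: (eq_linear_tens (L := SVproj (L := L') (V := V) \o tmap (ext1 F) idfun)
  (L' := SVproj (L := L) (V := V))) => s v /=.
by rewrite tmapE !SVprojE.
Qed.

End TransportModule.

(** Conjugating [module_formula] by F: the first term gives Q' = F Q G, and in
    the second one the left factor becomes F o parity o G = parity. *)
Theorem transport_module (K : fieldType) (L L' V : int -> lmodType K)
    (F : {linear rsym (shift L) -> rsym (shift L')})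
    (G : {linear rsym (shift L') -> rsym (shift L)})
    (Q : {linear rsym (shift L) -> rsym (shift L)})
    (phi : {linear tens (sym (shift L)) (dsum V) -> tens (sym (shift L)) (dsum V)}) :
    Linfty_module Q phi -> cancel F G -> cancel G F ->
    has_degree (@shomog K (shift L)) (@shomog K (shift L')) 0 F ->
    has_degree (@shomog K (shift L')) (@shomog K (shift L)) 0 G ->
    (forall x, coprod (F x) = tmap F F (coprod x)) ->
  let phi' := tmap (ext1 F) idfun \o phi \o tmap (ext1 G) idfun in
  Linfty_module (F \o Q \o G) phi' /\ induced_module G phi phi'.
Proof.
move=> hphi FK GK F_deg G_deg F_co phi'.
have G_co := inverse_coalgebra_morphism FK GK F_co.
have [phi_deg phi2 _] := hphi.
have phi'E x : component phi' x = component phi (tmap (ext1 G) idfun x).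
  exact: SVproj_ext1.
split=> //; split=> [d x xd|x|w v].
- rewrite -[d + 1]addr0; apply/(SVhomog_ext1 F_deg)/phi_deg; rewrite -[d]addr0.
  exact: (SVhomog_ext1 G_deg).
- rewrite /= tmap_comp (eq_tmap (f' := idfun) (g' := idfun)) ?tmap_id ?phi2
    ?linear0 //.
  by case=> c y; rewrite /= /ext1 /= FK.
rewrite -action_on_coprod /phi' /= tmapE (module_formula hphi).
rewrite full_coprod_ext1 // linearD; congr (_ + _); first by rewrite /= tmapE.
move: (full_coprod _) => t.
apply: (eq_linear_tens
  (L := tmap (ext1 F) idfun \o action_on phi (din v) \o tmap (ext1 G) (ext1 G))
  (L' := action_on phi' (din v))) => s s' /=.
rewrite tmapE !action_onE phi'E !tmapE /=; congr (_ ⊗ _).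
case: s => c y; rewrite /ext1 /=; congr pair.
by rewrite (parity_commute G_deg) GK.
Qed.

(** * A section of the multiplication *)

Lemma linfunE (K : fieldType) (A B : vectType K) (g : A -> B) :
  linear g -> linfun g =1 g.
Proof.
move=> lin_g; pose L : {linear A -> B} :=
  HB.pack g (GRing.isLinear.Build K A B _ g lin_g).
exact: (lfunE L).
Qed.

Lemma tensor_evaluation (K : fieldType) (V0 V1 : vectType K) (A : 'Hom(V0, V1)) :
  exists ev : {linear tens V0 'Hom(V1, K^o) -> K^o},
    forall v (xi : 'Hom(V1, K^o)), ev (v ⊗ xi) = xi (A v).
Proof.
have evl (xi : 'Hom(V1, K^o)) : linear (fun v => xi (A v)).
  by move=> c u v; rewrite !linearP.
have evr v : linear (fun xi : 'Hom(V1, K^o) => xi (A v)).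
  by move=> c x y; rewrite add_lfunE scale_lfunE.
have [ev evE] := pack_linear (tlift_is_linear evl evr).
by exists ev => v xi; rewrite evE (tliftE evl evr).
Qed.

(** Every functional on Hom(V0, V1) is the evaluation against an element of
    V0 ⊗ V1^*: expand it in a basis of elementary maps. *)
Lemma functional_on_Hom (K : fieldType) (V0 V1 : vectType K)
    (lambda : {linear 'Hom(V0, V1) -> K^o}) :
  exists T : tens V0 'Hom(V1, K^o),
    forall (A : 'Hom(V0, V1)) (ev : {linear tens V0 'Hom(V1, K^o) -> K^o}),
    (forall v (xi : 'Hom(V1, K^o)), ev (v ⊗ xi) = xi (A v)) -> ev T = lambda A.
Proof.
pose e := vbasis {:V0}; pose b := vbasis {:V1}.
pose E i j : 'Hom(V0, V1) := linfun (fun v => coord e i v *: b`_j).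
pose xi j : 'Hom(V1, K^o) := linfun (coord b j : V1 -> K^o).
have EE i j v : E i j v = coord e i v *: b`_j.
  by apply: (linfunE (g := fun v => coord e i v *: b`_j)) => c x y;
    rewrite linearP scalerDl scalerA.
have xiE j v : xi j v = coord b j v.
  by apply: (linfunE (g := coord b j : V1 -> K^o)) => c x y; rewrite linearP.
exists (\sum_i \sum_(j < \dim {:V1}) (lambda (E i j) : K) *: (e`_i ⊗ xi j)).
move=> A ev evE.
rewrite linear_sum.
transitivity (lambda (\sum_(i < \dim {:V0}) \sum_(j < \dim {:V1})
    coord b j (A e`_i) *: E i j)).
  rewrite linear_sum; apply: eq_bigr => i _; rewrite !linear_sum.
  apply: eq_bigr => j _; rewrite !linearZ evE xiE.
  exact: mulrC.
congr (lambda _); apply/lfunP => v; rewrite sum_lfunE.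
rewrite [in RHS](coord_vbasis (memvf v)) linear_sum; apply: eq_bigr => i _.
rewrite linearZ /= [in RHS](coord_vbasis (memvf (A e`_i))) scaler_sumr sum_lfunE.
by apply: eq_bigr => j _; rewrite scale_lfunE EE !scalerA mulrC.
Qed.

(** [pi_map] is the transpose of mu : x |-> m_2(x, _).  A functional vanishing on
    the image of mu corresponds to a tensor killed by [pi_map], so it is zero;
    hence mu is onto and has a linear section. *)
Theorem section_of_injective_pi (K : fieldType) (M V : int -> vectType K)
    (phi : {linear tens (sym (shift M)) (dsum V) -> tens (sym (shift M)) (dsum V)}) :
    injective (pi_map phi) ->
  exists s : {linear 'Hom(V 0, V 1) -> M 1}, forall A v, m2 phi (s A) v = A v.
Proof.
move=> pi_inj.
have m2l v : linear (fun x => m2 phi x v).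
  by move=> c x y; rewrite /m2 module_mult2l linearP.
have m2r x : linear (m2 phi x).
  by move=> c u v; rewrite /m2 module_mult2r linearP.
pose mu0 x : 'Hom(V 0, V 1) := linfun (m2 phi x).
have mu0E x v : mu0 x v = m2 phi x v by apply: linfunE.
have mu0l : linear mu0.
  move=> c x y; apply/lfunP => v.
  by rewrite add_lfunE scale_lfunE !mu0E m2l.
pose mu : 'Hom(M 1, 'Hom(V 0, V 1)) := linfun mu0.
have muE x v : mu x v = m2 phi x v by rewrite /mu linfunE.
have mu_onto A : A \in limg mu.
  (* [P] vanishes exactly on the image, and its coordinates are functionals. *)
  pose P : {linear 'Hom(V 0, V 1) -> 'Hom(V 0, V 1)} := idfun \- projv (limg mu).
  suff : P A = 0.
    rewrite /P /= => /eqP; rewrite subr_eq0 => /eqP e; rewrite e.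
    exact: memv_proj.
  rewrite (coord_vbasis (memvf (P A))) big1 // => i _.
  pose lambda : {linear 'Hom(V 0, V 1) -> K^o} := coord (vbasis fullv) i \o P.
  have [T TE] := functional_on_Hom lambda.
  suff T0 : T = 0.
    have lA : lambda A = 0.
      have [ev evE] := tensor_evaluation A.
      by rewrite -(TE A ev evE) T0 linear0.
    by rewrite [coord _ _ _]lA scale0r.
  apply: pi_inj; rewrite linear0; apply/lfunP => x; rewrite zero_lfunE.
  transitivity (lambda (mu x)); last first.
    by rewrite /lambda /= projv_id ?subrr ?linear0 // memv_img ?memvf.
  have [ev evE] : exists ev : {linear tens (V 0) 'Hom(V 1, K^o) -> K^o},
      forall T', ev T' = pi_map phi T' x.
    by apply: pack_linear => c T' T''; rewrite linearP add_lfunE scale_lfunE.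
  rewrite -evE; apply: TE => v xi; rewrite evE muE; exact: pi_mapE.
exists (mu^-1)%VF => A v.
by rewrite -muE limg_lfunVK.
Qed.

(** * Straightening the module structure *)

(** The degrees i and (i + 1) - 1 are equal but not convertible; uniqueness of
    equality proofs on integers removes the cast. *)
Lemma desusp_susp (K : fieldType) (L : int -> lmodType K) (x : hel (shift L)) :
  desusp (susp x) = x.
Proof.
case: x => i x; rewrite /desusp /susp /Hel /=.
have cast_id j (e : j = i) (e' : i + 1 = j + 1) :
    @Hel K (shift L) j (ecast k (L k) e' x) = Hel x.
  by case: i / e x e' => x e'; rewrite (eq_axiomK e').
by apply: cast_id; rewrite addrK.
Qed.

Lemma din0 (K : fieldType) (W : int -> lmodType K) i :
  din (Hel (0 : W i)) = 0 :> dsum W.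
Proof.
have := dinD 1 (0 : W i) 0; rewrite !scale1r addr0 => /eqP.
by rewrite -subr_eq subrr eq_sym => /eqP.
Qed.

Lemma vee_letter0 (K : fieldType) (W : int -> lmodType K) i :
  vee [:: Hel (0 : W i)] = 0.
Proof.
have := (vee_graded_symmetric W).1 [::] i 1 0 0 [::].
rewrite !scale1r addr0 => /eqP.
by rewrite -subr_eq subrr eq_sym => /eqP.
Qed.

Lemma SVproj_homog (K : fieldType) (L V : int -> lmodType K) d
    (x : tens (sym (shift L)) (dsum V)) :
  SVhomog d x -> exists y : V d, SVproj x = din (Hel y).
Proof.
elim=> [|c _ z [[w v] /= wv ->] _ [y zE]]; first by exists 0; rewrite linear0 din0.
rewrite linearP /= zE SVprojE /=.
case: w wv => [|a w] wv; last by exists y; rewrite scale0r scaler0 add0r.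
move: wv; rewrite wdeg_nil add0r; case: v => i v /= id_.
by case: d / id_ y {zE} => y; exists (c *: v + y); rewrite dinD scale1r.
Qed.

Section Straightening.
Variables (K : fieldType) (M V : int -> vectType K).
Variable phi :
  {linear tens (sym (shift M)) (dsum V) -> tens (sym (shift M)) (dsum V)}.
Variable s : {linear 'Hom(V 0, V 1) -> M 1}.
Local Notation W := (shift M).

(** The sign makes the linear part equal to m_2 = - dec phi_2. *)
Definition operator_of (x : rsym W) : 'Hom(V 0, V 1) :=
  linfun (fun v : V 0 => - dproj 1 (component phi (sym_incl x ⊗ din (Hel v)))).

Lemma operator_ofE x v :
  operator_of x v = - dproj 1 (component phi (sym_incl x ⊗ din (Hel v))).
Proof.
apply: (linfunE (g := fun v : V 0 =>
  - dproj 1 (component phi (sym_incl x ⊗ din (Hel v))))) => c u u'.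
by rewrite dinD tpureDr /component !linearP.
Qed.

Lemma operator_of_is_linear : linear operator_of.
Proof.
move=> c x y; apply/lfunP => v; rewrite add_lfunE scale_lfunE !operator_ofE.
by rewrite (linearP (@sym_incl K W : {linear _ -> _})) tpureDl /component !linearP.
Qed.

HB.instance Definition _ :=
  GRing.isLinear.Build K (rsym W) 'Hom(V 0, V 1) _ operator_of operator_of_is_linear.

(** The value in other degrees has to be a zero of the degree of [w], in order
    that the letter returned always have the degree of the word. *)
Definition straighten (w : seq (hel W)) : hel W :=
  if w is [:: a] then a
  else if wdeg w == 0 then @Hel K W 0 (s (operator_of (vee w)))
  else @Hel K W (wdeg w) 0.

Lemma straighten_deg w : tag (straighten w) = wdeg w.
Proof.
rewrite /straighten; case: w => [|a [|b w]]; last by case: eqP => // ->.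
  by rewrite wdeg_nil.
by rewrite wdeg_cons wdeg_nil addr0.
Qed.

Lemma straighten_sym : graded_symmetric (fun w => din (straighten w)).
Proof.
have [Lam LamE] : exists Lam : {linear rsym W -> dsum W},
    forall x, Lam x = din (@Hel K W 0 (s (operator_of x))).
  by apply: pack_linear => c x y; rewrite !linearP dinD.
pose curved (w : seq (hel W)) := (size w != 1)%N && (wdeg w == 0).
pose g w := if curved w then Lam (vee w) else 0.
have strE w : din (straighten w) = slin (vee w) + g w.
  rewrite slinE /g /curved LamE.
  case: w => [|a [|b w]] /=; [|by rewrite addr0|]; rewrite add0r.
    by case: eqP => // _; rewrite din0.
  by case: eqP => // _; rewrite din0.
have [vl vs] := vee_graded_symmetric W.
have [ll ls] := graded_symmetric_linear Lam (vee_graded_symmetric W).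
have [sl ss] := graded_symmetric_linear slin (vee_graded_symmetric W).
split=> [u i c x y v|u a b v]; rewrite !strE.
  have e z : curved (u ++ @Hel K W i z :: v) = curved (u ++ @Hel K W i x :: v).
    by rewrite /curved !size_cat !wdeg_cat !wdeg_cons.
  rewrite sl /g !(e (_ + _)) !(e y); case: (curved _).
    by rewrite ll scalerDr addrACA.
  by rewrite !addr0.
have e : curved (u ++ a :: b :: v) = curved (u ++ b :: a :: v).
  by rewrite /curved !size_cat !wdeg_cat !wdeg_cons (addrCA (tag a)).
rewrite ss scalerDr /g e; case: (curved _); first by rewrite ls.
by rewrite scaler0.
Qed.

Lemma operator_of_letter (y : M 1) v :
  operator_of (vee [:: @Hel K W 0 y]) v = m2 phi y v.
Proof.
rewrite operator_ofE /m2 /module_mult dec_sign1 scale1r linearN.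
have -> : map (@desusp K M) [:: Hel y] = [:: @Hel K W 0 y].
  by congr [:: _]; apply: (desusp_susp (@Hel K W 0 y)).
by [].
Qed.

Hypothesis s_section : forall A v, m2 phi (s A) v = A v.

(** On words with two letters or more this is the choice of [straighten] and the
    section property of [s]; on single letters [straighten] is the identity. *)
Lemma operator_straightened (F : {linear rsym W -> rsym W}) :
    (forall w, slin (F (vee w)) = if w is [::] then 0 else din (straighten w)) ->
  forall x, shomog 0 x ->
    exists y : M 1, slin (F x) = din (@Hel K W 0 y) /\
      operator_of x = operator_of (vee [:: @Hel K W 0 y]).
Proof.
move=> F_lin x; have [vl _] := vee_graded_symmetric W.
elim=> [|c _ z [w w0 ->] _ [y [yE opE]]].
  by exists 0; rewrite !linear0 din0 vee_letter0 !linear0.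
suff [y' [y'E opE']] : exists y' : M 1, slin (F (vee w)) = din (@Hel K W 0 y') /\
    operator_of (vee w) = operator_of (vee [:: @Hel K W 0 y']).
  exists (c *: y' + y); rewrite !linearP /= yE y'E opE opE' dinD; split=> //.
  by rewrite -linearP; congr operator_of; rewrite (vl [::]).
rewrite F_lin; case: w w0 => [|a [|b w]] w0.
- by exists 0; rewrite din0 vee_letter0 vee_nil.
- case: a w0 => i a; rewrite wdeg_cons wdeg_nil addr0 /= => i0.
  by move: a; rewrite i0 => a; exists a.
exists (s (operator_of (vee (a :: b :: w)))); rewrite /straighten w0 eqxx; split=> //.
by apply/lfunP => v; rewrite operator_of_letter s_section.
Qed.

Lemma component_homog x (v : V 0) :
  has_degree (@SVhomog K M V) (@SVhomog K M V) 1 phi -> shomog 0 x ->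
  operator_of x = 0 -> component phi (sym_incl x ⊗ din (Hel v)) = 0.
Proof.
move=> phi_deg x0 opx0.
have [y yE] : exists y : V 1,
    component phi (sym_incl x ⊗ din (Hel v)) = din (Hel y).
  exact: SVproj_homog (phi_deg _ _ (SVhomog_incl (Hel v) x0)).
have := operator_ofE x v; rewrite opx0 zero_lfunE yE dprojE => /esym/eqP.
by rewrite oppr_eq0 => /eqP ->; rewrite din0.
Qed.

End Straightening.

Theorem theorem13p1 (K : fieldType) (charK : [pchar K] =i pred0)
    (M V : int -> vectType K)
    (Q : {linear rsym (shift M) -> rsym (shift M)})
    (phi : {linear tens (sym (shift M)) (dsum V) -> tens (sym (shift M)) (dsum V)})
    (hQ : Linfty_algebra Q) (hphi : Linfty_module Q phi)
    (M01 : forall i : int, i != 0 -> i != 1 -> forall x : M i, x = 0)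
    (V01 : forall i : int, i != 0 -> i != 1 -> forall v : V i, v = 0)
    (dM0 : forall x : hel M, Linfty_bracket Q [:: x] = 0)
    (dV0 : forall v : hel V, module_mult phi [::] v = 0)
    (pi_inj : injective (pi_map phi)) :
  exists (Q' F G : {linear rsym (shift M) -> rsym (shift M)})
    (phi' : {linear tens (sym (shift M)) (dsum V) -> tens (sym (shift M)) (dsum V)}),
    [/\ Linfty_algebra Q',
        Linfty_iso Q Q' F G,
        Linfty_module Q' phi' /\ induced_module G phi phi',
        forall (x : hel M) (v : hel V),
          module_mult phi' [:: x] v = module_mult phi [:: x] v
      & forall (n : nat) (w : (n.-1).-tuple (M 1)) (v : V 0), (2 < n)%N ->
          module_mult phi' [seq Hel x | x <- w] (Hel v) = 0].
Proof.
have [s sE] := section_of_injective_pi pi_inj.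
pose f := straighten phi s.
have f_deg : forall w, tag (f w) = wdeg w := straighten_deg phi s.
have [F [FE F_deg F_co F_lin]] :=
  coalgebra_morphism_of_corestriction f_deg (straighten_sym phi s).
have [|G [FK GK G_deg]] := unipotent_inverse (F := F).
  move=> w; rewrite FE.
  apply: (block_sum_leading_term f_deg) => //;
    [exact: span0|exact: spanD|by move=> *; exact: spanZ|].
  by move=> t tw td; apply: span_gen; exists t.
have [Q'_alg FG_iso] := transport_algebra hQ FK GK F_deg G_deg F_co.
have [phi'_mod phi'_ind] := transport_module hphi FK GK F_deg G_deg F_co.
eexists; exists F, G; eexists; split;
  [exact: Q'_alg | exact: FG_iso | by split; [exact: phi'_mod |] | ..].
  move=> x v; rewrite /module_mult phi'_ind tmapE /=.
  congr (- (_ *: component _ (_ ⊗ _))).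
  suff Ga a : G (vee [:: a]) = vee [:: a] by rewrite /ext1 /svee /= Ga.
  by apply: (can_inj FK); rewrite GK FE block_sum_cons unshuffle_nil block_sum_nil.
move=> n w v n2; rewrite /module_mult phi'_ind tmapE /=.
set t := map (@desusp _ _) _.
have t_deg : wdeg t = 0.
  by rewrite /t /wdeg big_map big_map big1.
have t_long : (1 < size t)%N.
  by rewrite /t !size_map size_tuple; move: n2; case: (n).
have tE : svee t = sym_incl (vee t) :> sym (shift M).
  by rewrite /svee; case: (t) t_long.
have t_lin : slin (vee t) = 0 by rewrite slinE; case: (t) t_long => [|? []].
suff -> : component phi (ext1 G (svee t) ⊗ din (Hel v)) = 0.
  by rewrite scaler0 oppr0.
have Gt0 : shomog 0 (G (vee t)).
  by rewrite -[0]addr0; apply: G_deg; apply: span_gen; exists t.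
have [phi_deg _ _] := hphi.
rewrite tE; apply: component_homog => //.
have [y [yE ->]] := operator_straightened sE F_lin Gt0.
(* The linear part of F (G (vee t)) = vee t vanishes. *)
have y0 : y = 0 by rewrite -[y](@dprojE K (shift M) 0) -yE GK t_lin linear0.
by rewrite y0 vee_letter0 linear0.
Qed.
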